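(* If $\{\log S_n\}\ge 2^{-n}$ for infinitely many positive integers $n$, then $\gamma$ is irrational. In fact, for any given positive integer $n$, the inequality $\{\log S_n\}\ge 2^{-n}$ implies that whenever $p,q\in\mathbf{Z}$ and $q$ divides $d_{2n}\binom{2n}{n}$, then $\gamma\ne p/q$.
   Context: Here $\log$ is the natural logarithm; for real $x>0$, the fractional part $\{x\}$ is the number in $[0,1)$ with $x-\{x\}\in\mathbf{Z}$. Euler's constant is $\gamma := \lim_{N\to\infty}(H_N-\log N)$, where $H_N=\sum_{k=1}^N k^{-1}$. For a positive integer $m$, $d_m$ denotes the least common multiple of $1,2,\ldots,m$. For each positive integer $n$, $$S_n := \prod_{k=1}^{n}\ \prod_{i=0}^{\min(k-1,\,n-k)}\ \prod_{j=i+1}^{n-i} (n+k)^{\frac{2d_{2n}}{j}\binom{n}{i}^2},$$ which is a positive integer. *)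

(* Defs.v *)
From mathcomp Require Import all_boot all_order all_algebra.
From mathcomp Require Import all_classical all_reals all_analysis.

Set Implicit Arguments.
Unset Strict Implicit.
Unset Printing Implicit Defensive.

Import Order.TTheory GRing.Theory Num.Theory.
Import numFieldNormedType.Exports.

Local Open Scope ring_scope.
Local Open Scope classical_set_scope.

Definition lcm_upto (m : nat) : nat := \big[lcmn/1%N]_(1 <= k < m.+1) k.

Definition frac_part (R : realType) (x : R) : R := x - (Num.floor x)%:~R.

(* The term N = 0, where [ln 0 = 0], is irrelevant to the limit. *)
Definition euler_gamma (R : realType) : R :=
  limn (fun N : nat => \sum_(1 <= k < N.+1) (k%:R : R)^-1 - ln N%:R).

(* No natural-number subtraction truncates on these ranges. The real exponents
   are in fact natural numbers, since j <= n divides [lcm_upto (2 * n)]. *)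
Definition sondow_S (R : realType) (n : nat) : R :=
  \prod_(1 <= k < n.+1)
   \prod_(0 <= i < (minn (k - 1) (n - k)).+1)
    \prod_(i.+1 <= j < (n - i).+1)
     ((n + k)%:R `^ (2 * (lcm_upto (2 * n))%:R / j%:R * 'C(n, i)%:R ^+ 2)).

(* Main.v *)
Require Import Defs.
From Stdlib Require Import BinNat Nnat.
From mathcomp Require Import all_boot all_order all_algebra.
From mathcomp Require Import all_classical all_reals all_analysis.
From mathcomp Require Import ring lra zify.

Import Order.TTheory GRing.Theory Num.Theory.
Import numFieldNormedType.Exports.

Local Open Scope ring_scope.
Local Open Scope classical_set_scope.

(** Sondow's criterion rests on linear forms in [1], [euler_gamma] and logarithms
    that are positive and very small. Fix [n], write [d] for [lcm_upto (2 * n)] and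
    let [r t = n`! / (t * (t + 1) * ... * (t + n))]. The number
    [I = \sum_(v > n) \int_v^oo r t ^ 2 dt] is positive. Expanding [r ^ 2] into
    partial fractions, with double poles at [- i] of coefficient ['C(n, i) ^ 2] and
    with residues [2 * 'C(n, i) ^ 2 * (H_i - H_(n - i))], and integrating termwise
    gives [I = 'C(2 * n, n) * euler_gamma - A + L], where
    [A = \sum_i 'C(n, i) ^ 2 * H_(n + i)] and [d * L] is exactly
    [ln (sondow_S R n)]: the antisymmetry of the residues produces the range of
    products in [sondow_S]. As [d * A] is an integer, [euler_gamma = p / q] with [q]
    dividing [d * 'C(2 * n, n)] makes [ln (sondow_S R n) - d * I] an integer. So
    once [0 < d * I < 2 ^- n] is known, the fractional part of [ln (sondow_S R n)]
    is [d * I], which is below [2 ^- n]. This is [frac_part_sondow]; it is the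
    second claim, and the first one follows because every [q] divides
    [lcm_upto (2 * n)] as soon as [q <= 2 * n].

    The inner integral is the explicit function [tail_term], used through its
    derivative [- r ^ 2] and its limit [0] at infinity, and the outer sum telescopes
    up to convergent terms ([tail_primitive_cvg]). The bound
    [I <= 4 / ((2 * n + 1) * 'C(2 * n, n)) ^ 2], of size [16 ^- n], comes from a
    function [majorant] whose second difference dominates [r ^ 2].

    It remains to bound [d] by [8 ^ n], that is, to prove Chebyshev's estimate
    [psi m <= c * m] with [c = 3 / 2 * ln 2 = 1.0397...] for all [m] ([psi_le]).
    Chebyshev's original choice of factorials gives only [1.1056], and a larger
    combination is used here: integers [nu d] such that the step function
    [\sum_d nu d * (t %/ d)] is at least [1] for small [t] and never far below it.
    Such an inequality between step functions turns into one between values of [psi]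
    and of logarithms of factorials ([chebyshev_transfer]), because
    [ln n`! = \sum_(q <= n) mangoldt q * (n %/ q)] with [0 <= mangoldt q]. By
    Stirling's formula it bounds [psi N] by values of [psi] at much smaller
    arguments plus a main term with a slope below [c], which proves the estimate by
    induction for [20 * 1024 <= N]. Smaller [N] are covered by a sieve. Both finite
    verifications, of the step function and of the small cases, are run on countdown
    counters instead of divisions, to keep the evaluation short. *)

(** * The lcm of the first integers and factorials *)

Lemma lcm_uptoS m : lcm_upto m.+1 = lcmn (lcm_upto m) m.+1.
Proof. by rewrite /lcm_upto big_nat_recr. Qed.

Lemma lcm_upto_gt0 m : (0 < lcm_upto m)%N.
Proof.
elim: m => [|m IHm]; first by rewrite /lcm_upto big_geq.
by rewrite lcm_uptoS lcmn_gt0 IHm.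
Qed.

Lemma dvdn_lcm_upto m k : (0 < k <= m)%N -> (k %| lcm_upto m)%N.
Proof.
elim: m => [|m IHm]; first by case: k.
rewrite lcm_uptoS => /andP[k0]; rewrite leq_eqVlt => /orP[/eqP->|km].
  exact: dvdn_lcmr.
by apply: dvdn_trans (IHm _) (dvdn_lcml _ _); rewrite k0.
Qed.

Lemma lcm_upto_dvd m k : (m <= k)%N -> (lcm_upto m %| lcm_upto k)%N.
Proof.
move/subnK<-; elim: (k - m)%N => [|d IHd] //.
by rewrite addSn lcm_uptoS; apply: dvdn_trans IHd (dvdn_lcml _ _).
Qed.

Lemma leq_lcm_upto m k : (m <= k)%N -> (lcm_upto m <= lcm_upto k)%N.
Proof. by move=> mk; rewrite dvdn_leq ?lcm_upto_gt0 ?lcm_upto_dvd. Qed.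

(** A prime power divides an lcm only if it divides one of the terms. *)
Lemma prime_pow_dvd_lcm_upto p e m : prime p -> (0 < m)%N ->
  (p ^ e %| lcm_upto m)%N = (p ^ e <= m)%N.
Proof.
move=> pp; elim: m => [//|[_ _|m /(_ isT) IHm _]].
  rewrite /lcm_upto big_nat1 dvdn1; case: e => [|e] //.
  have p1 : (1 < p ^ e.+1)%N by rewrite -{1}(exp1n e.+1) ltn_exp2r ?prime_gt1.
  by rewrite gtn_eqF // leqNgt p1.
rewrite lcm_uptoS pfactor_dvdn ?lcmn_gt0 ?lcm_upto_gt0 // logn_lcm ?lcm_upto_gt0 //.
rewrite leq_max -!pfactor_dvdn ?lcm_upto_gt0 // IHm.
apply/orP/idP => [[/leqW //|/dvdn_leq-> //]|].
rewrite leq_eqVlt => /orP[/eqP->|]; first by right.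
by rewrite ltnS; left.
Qed.

Lemma lognM_prod p n (F : nat -> nat) : (forall k, 0 < F k)%N ->
  (logn p (\prod_(1 <= k < n.+1) F k) = \sum_(1 <= k < n.+1) logn p (F k))%N.
Proof.
move=> F0; elim: n => [|n IHn]; first by rewrite !big_geq // logn1.
by rewrite big_nat_recr //= [in RHS]big_nat_recr //= lognM ?IHn ?prodn_gt0.
Qed.

(** Both sides have the same [p]-adic valuation for every prime [p], namely the
    number of pairs [(k, e)] with [0 < e] and [k * p ^ e <= n]. *)
Lemma fact_prod_lcm_upto n : (n`! = \prod_(1 <= k < n.+1) lcm_upto (n %/ k))%N.
Proof.
apply: eqn_from_log => [|| p]; first exact: fact_gt0.
  by rewrite prodn_gt0 // => k; apply: lcm_upto_gt0.
case: (boolP (prime p)) => [pp|npp]; last by rewrite /logn (negbTE npp).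
rewrite logn_fact // lognM_prod => [|k]; last exact: lcm_upto_gt0.
have count a : (a <= n)%N -> (\sum_(1 <= k < n.+1) (k <= a) = a)%N.
  move=> an; rewrite (@big_cat_nat _ _ _ a.+1) //=.
  rewrite [X in (X + _)%N](eq_big_nat _ _ (F2 := fun=> 1%N)).
    rewrite sum_nat_const_nat subn1 muln1 big_nat_cond big1 ?addn0 // => k.
    by rewrite andbT => /andP[ak _]; rewrite leqNgt ak.
  by move=> k /andP[_]; rewrite ltnS => ->.
have -> : (\sum_(1 <= k < n.+1) n %/ p ^ k =
           \sum_(1 <= e < n.+1) \sum_(1 <= k < n.+1) (k <= n %/ p ^ e))%N.
  by apply: eq_bigr => e _; rewrite count // leq_div.
rewrite exchange_big /=; apply: eq_big_nat => k /andP[k0 kn].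
have nk0 : (0 < n %/ k)%N by rewrite divn_gt0.
set L := lcm_upto (n %/ k).
have e0 := prime_pow_dvd_lcm_upto p _ _ pp nk0.
have an : (logn p L <= n)%N.
  apply: leq_trans (ltnW (ltn_expl _ (prime_gt1 pp))) _.
  by rewrite (leq_trans _ (leq_div n k)) // -e0 pfactor_dvdnn.
(* The exponent [logn p L] is itself counted as the number of [e] below it. *)
rewrite -(count _ an); apply: eq_big_nat => e _; congr (nat_of_bool _).
rewrite -pfactor_dvdn ?lcm_upto_gt0 // e0 !leq_divRL ?expn_gt0 ?(prime_gt0 pp) //.
by rewrite mulnC.
Qed.

(** * Chebyshev functions *)

(** The second Chebyshev function. *)
Definition psi (R : realType) (m : nat) : R := ln (lcm_upto m)%:R.

(** Von Mangoldt's function: the lcm of [1, ..., q] gains a factor only when [q]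
    is a power of a prime [p], and that factor is [p]. *)
Definition mangoldt (R : realType) (q : nat) : R := psi R q - psi R q.-1.

Lemma psi0 (R : realType) : psi R 0 = 0.
Proof. by rewrite /psi /lcm_upto big_geq // ln1. Qed.

Lemma mangoldt_ge0 (R : realType) q : 0 <= mangoldt R q.
Proof.
rewrite subr_ge0 /psi ler_ln ?posrE ?ltr0n ?lcm_upto_gt0 //.
by rewrite ler_nat leq_lcm_upto // leq_pred.
Qed.

Lemma psi_sum_mangoldt (R : realType) N m : (m <= N)%N ->
  psi R m = \sum_(1 <= q < N.+1) mangoldt R q * (q <= m)%:R.
Proof.
move=> mN; rewrite (@big_cat_nat _ _ _ m.+1) //=.
rewrite [X in _ + X]big_nat_cond [X in _ + X]big1 ?addr0 => [|q]; last first.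
  by rewrite andbT => /andP[mq _]; rewrite leqNgt mq mulr0.
rewrite (eq_big_nat _ _ (F2 := mangoldt R)) => [|q /andP[_]]; last first.
  by rewrite ltnS => ->; rewrite mulr1.
rewrite big_add1 /= (eq_bigr (fun q => psi R q.+1 - psi R q)) //.
by rewrite telescope_sumr // psi0 subr0.
Qed.

Lemma ln_prod_nat (R : realType) n (F : nat -> nat) : (forall k, 0 < F k)%N ->
  ln ((\prod_(1 <= k < n.+1) F k)%N%:R : R) = \sum_(1 <= k < n.+1) ln (F k)%:R.
Proof.
move=> F0; elim: n => [|n IHn]; first by rewrite !big_geq // ln1.
rewrite big_nat_recr //= [in RHS]big_nat_recr //= natrM lnM ?IHn //.
  by rewrite posrE ltr0n prodn_gt0.
by rewrite posrE ltr0n F0.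
Qed.

Lemma sum_leq_divn a q : (0 < q)%N ->
  (\sum_(1 <= k < a.+1) (q <= a %/ k))%N = (a %/ q)%N.
Proof.
move=> q0; rewrite (@big_cat_nat _ _ _ (a %/ q).+1) //=; last first.
  by rewrite ltnS leq_div.
rewrite (eq_big_nat _ _ (F2 := fun=> 1%N)) => [|k /andP[k0]]; last first.
  by rewrite ltnS !leq_divRL // mulnC => ->.
rewrite sum_nat_const_nat subn1 muln1 big_nat_cond big1 ?addn0 // => k.
rewrite andbT => /andP[ak _]; have k0 : (0 < k)%N by apply: leq_trans ak.
by move: ak; rewrite leq_divRL // ltn_divLR // mulnC ltnNge => /negbTE ->.
Qed.

(** Chebyshev's identity, with a summation range [N] independent of [a], so that
    the sums for different [a] can be combined termwise. *)
Lemma ln_fact_mangoldt (R : realType) N a : (a <= N)%N ->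
  ln (a`!%:R : R) = \sum_(1 <= q < N.+1) mangoldt R q * (a %/ q)%:R.
Proof.
move=> aN; rewrite fact_prod_lcm_upto ln_prod_nat => [|k]; last exact: lcm_upto_gt0.
rewrite (eq_bigr (fun k => \sum_(1 <= q < N.+1) mangoldt R q * (q <= a %/ k)%:R)).
  rewrite exchange_big /=; apply: eq_big_nat => q /andP[q0 _].
  by rewrite -mulr_sumr -natr_sum sum_leq_divn.
by move=> k _; rewrite -psi_sum_mangoldt // (leq_trans (leq_div _ _)).
Qed.

(** Chebyshev's method: an inequality between step functions of [t] becomes one
    between Chebyshev functions and factorials, by summing it over [t = N / q]
    with the nonnegative weights [mangoldt q]. *)
Lemma chebyshev_transfer (R : realType) N (s : seq (nat * R)) (ks : seq nat) :
  all (leq 1) ks ->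
  (forall t, (0 < t)%N ->
     1 <= \sum_(x <- s) x.2 * (t %/ x.1)%:R + (count (fun k => k <= t)%N ks)%:R) ->
  psi R N <= \sum_(x <- s) x.2 * ln (N %/ x.1)`!%:R + \sum_(k <- ks) psi R (N %/ k).
Proof.
move=> /allP ks0 hF.
rewrite (psi_sum_mangoldt R _ _ (leqnn N)).
rewrite (eq_bigr (fun x => \sum_(1 <= q < N.+1)
   mangoldt R q * (x.2 * (N %/ q %/ x.1)%:R))); last first.
  move=> x _; rewrite (ln_fact_mangoldt R _ _ (leq_div N x.1)) mulr_sumr.
  by apply: eq_bigr => q _; rewrite divnAC mulrCA.
rewrite [X in _ + X](eq_big_seq (fun k => \sum_(1 <= q < N.+1)
   mangoldt R q * (k <= N %/ q)%:R)); last first.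
  move=> k /ks0 k0; rewrite (psi_sum_mangoldt R _ _ (leq_div N k)).
  by apply: eq_big_nat => q /andP[q0 _]; rewrite !leq_divRL // mulnC.
rewrite exchange_big [X in _ + X]exchange_big /= -big_split /=.
rewrite big_nat_cond [leRHS]big_nat_cond; apply: ler_sum => q.
rewrite andbT => /andP[q0]; rewrite ltnS => qN.
rewrite qN -!mulr_sumr -mulrDr ler_wpM2l ?mangoldt_ge0 //.
rewrite -natr_sum.
have := hF (N %/ q)%N; rewrite divn_gt0 // qN => /(_ isT) /le_trans; apply.
rewrite lerD2l ler_nat -sum1_count big_mkcond /=.
by apply: leq_sum => k _; case: (k <= _)%N.
Qed.

(** * Stirling's formula with explicit bounds *)

Lemma mvt_is_derive (R : realType) (f df : R -> R) (a b : R) : a < b ->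
  (forall x, a <= x <= b -> is_derive x 1 f (df x)) ->
  exists2 c, a < c < b & f b - f a = df c * (b - a).
Proof.
move=> ab fd.
have [|| c] := @MVT R f df a b ab.
- by move=> x; rewrite in_itv /= => /andP[ax xb]; apply: fd; rewrite !ltW.
- apply: derivable_within_continuous => x; rewrite in_itv /= => abx.
  by have [] := fd x abx.
- by rewrite in_itv /= => acb e; exists c.
Qed.

Lemma is_derive_affine (R : realType) (a b x : R) :
  is_derive x 1 (fun y => a + b * y) b.
Proof. by apply: is_derive_eq; rewrite add0r /GRing.scale /= mul1r mulr1. Qed.

Lemma is_derive_ln_affine (R : realType) (a b x : R) : 0 < a + b * x ->
  is_derive x 1 (fun y => ln (a + b * y)) (b / (a + b * x)).
Proof.
move=> h; have d1 := is_derive_affine R a b x; have d2 := is_derive1_ln h.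
have := @is_derive1_comp _ (@ln R) (fun y => a + b * y) x _ _ d2 d1.
by rewrite mulrC.
Qed.

(** The derivative of the difference, [2 * c ^ 2 / (1 - c ^ 2)], is nonnegative. *)
Lemma ln_odds_ge (R : realType) (v : R) : 0 <= v < 1 -> 2 * v <= ln (1 + v) - ln (1 - v).
Proof.
move=> /andP[v0 v1]; have [->|vn0] := eqVneq v 0; first by rewrite !addr0 subr0 subrr mulr0.
have {vn0} v0 : 0 < v by rewrite lt_neqAle eq_sym vn0.
pose f (x : R) := ln (1 + 1 * x) - ln (1 + -1 * x) + (0 + - 2 * x).
have [|c /andP[c0 cv]] := mvt_is_derive R f
    (fun x => 1 / (1 + 1 * x) - -1 / (1 + -1 * x) + - 2) 0 v v0.
  move=> x /andP[x0 xv]; rewrite /f.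
  have h1 : 0 < 1 + 1 * x by lra.
  have h2 : 0 < 1 + -1 * x by lra.
  have d1 := is_derive_ln_affine R _ _ _ h1.
  have d2 := is_derive_ln_affine R _ _ _ h2.
  have d3 := is_derive_affine R 0 (- 2) x.
  exact: is_derive_eq.
rewrite /f !(mulr0, addr0, mul1r, mulN1r, mulNr, subr0, subrr, add0r, ln1, oppr0, opprK) => e.
rewrite -subr_ge0 e mulr_ge0 ?(ltW v0) //.
have c1 : 0 < 1 + c by lra.
have c2 : 0 < 1 - c by lra.
have -> : (1 + c)^-1 + (1 - c)^-1 - 2 = 2 * c ^+ 2 / ((1 + c) * (1 - c)).
  by field; rewrite !gt_eqF.
by rewrite divr_ge0 ?mulr_ge0 ?sqr_ge0 ?ltW.
Qed.

(** The difference vanishes at [0] and has the derivative [ln (1 - u ^ 2)]. *)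
Lemma xlnx_odds_le (R : realType) (u : R) : 0 <= u < 1 ->
  (1 + u) * ln (1 + u) - (1 - u) * ln (1 - u) <= 2 * u.
Proof.
move=> /andP[v0 v1]; have [->|vn0] := eqVneq u 0.
  by rewrite !addr0 subr0 ln1 !mulr0 subr0.
have {vn0} v0 : 0 < u by rewrite lt_neqAle eq_sym vn0.
pose f (x : R) := (1 + 1 * x) * ln (1 + 1 * x) - (1 + -1 * x) * ln (1 + -1 * x)
  + (0 + - 2 * x).
have [|c /andP[c0 cv]] := mvt_is_derive R f
    (fun x => ln (1 + 1 * x) + ln (1 + -1 * x)) 0 u v0.
  move=> x /andP[x0 xv]; rewrite /f.
  have h1 : 0 < 1 + 1 * x by lra.
  have h2 : 0 < 1 + -1 * x by lra.
  have d1 := is_derive_ln_affine R _ _ _ h1.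
  have d2 := is_derive_ln_affine R _ _ _ h2.
  have d3 := is_derive_affine R 0 (- 2) x.
  have d4 := is_derive_affine R 1 1 x.
  have d5 := is_derive_affine R 1 (-1) x.
  apply: is_derive_eq; rewrite /GRing.scale /=.
  by field; rewrite !gt_eqF //; lra.
rewrite /f !(mulr0, addr0, mul1r, mulN1r, mulNr, subr0, subrr, add0r, ln1, oppr0, opprK) => e.
rewrite -subr_le0 e mulr_le0_ge0 ?(ltW v0) //.
have c1 : 0 < 1 + c by lra.
have c2 : 0 < 1 - c by lra.
rewrite -lnM ?posrE // ln_le0 //; nra.
Qed.

(** The trapezoidal rule underestimates the integral of the concave function [ln]
    on each unit interval; this is [ln_odds_ge] at [1 / (2 * a + 1)]. *)
Lemma ln_fact_le (R : realType) (M : nat) : (0 < M)%N ->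
  ln (M`!%:R : R) <= (M%:R + 2^-1) * ln M%:R - M%:R + 1.
Proof.
case: M => // M _; elim: M => [|M IHM]; first by rewrite ln1 mulr0; lra.
rewrite factS natrM lnM ?posrE ?ltr0n ?fact_gt0 //.
set a : R := M.+1%:R; have a0 : 0 < a by rewrite ltr0n.
have -> : M.+2%:R = a + 1 by rewrite -natr1.
have h : 2 * (2 * a + 1)^-1 <= ln (a + 1) - ln a.
  have h0 : 0 < 2 * a + 1 by lra.
  have v01 : 0 <= (2 * a + 1)^-1 < 1.
    by rewrite invr_ge0 ltW //= invf_lt1 //; lra.
  have := ln_odds_ge R _ v01.
  have -> : 1 + (2 * a + 1)^-1 = (a + 1) * (2 / (2 * a + 1)).
    by field; rewrite gt_eqF.
  have -> : 1 - (2 * a + 1)^-1 = a * (2 / (2 * a + 1)).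
    by field; rewrite gt_eqF.
  have h2 : 0 < 2 / (2 * a + 1) by rewrite divr_gt0.
  by rewrite !lnM ?posrE //; lra.
have {}h : 1 <= (a + 2^-1) * (ln (a + 1) - ln a).
  have := ler_wpM2l (_ : 0 <= a + 2^-1) h; rewrite (_ : (a + _) * (2 * _) = 1).
    by apply; lra.
  by field; rewrite gt_eqF //; lra.
move: IHM; rewrite -/a; lra.
Qed.

(** The midpoint rule overestimates the same integral; this is [xlnx_odds_le] at
    [1 / (2 * a)]. *)
Lemma ln_fact_ge (R : realType) (M : nat) :
  (M%:R + 2^-1) * ln (M%:R + 2^-1) - M%:R + ln 2 / 2 <= ln (M`!%:R : R).
Proof.
elim: M => [|M IHM]; first by rewrite add0r lnV ?posrE // ln1; lra.
rewrite factS natrM lnM ?posrE ?ltr0n ?fact_gt0 //.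
set a : R := M.+1%:R; have a0 : 1 <= a by rewrite ler1n.
have a1 : 0 < a by lra.
have hM : M%:R = a - 1 by rewrite /a -natr1 addrK.
have u01 : 0 <= (2 * a)^-1 < 1.
  by rewrite invr_ge0 mulr_ge0 ?ltW //= invf_lt1; lra.
have := xlnx_odds_le R _ u01.
have -> : 1 + (2 * a)^-1 = (a + 2^-1) / a by field; rewrite gt_eqF.
have -> : 1 - (2 * a)^-1 = (a - 2^-1) / a by field; rewrite gt_eqF.
have h1 : 0 < a + 2^-1 by lra.
have h2 : 0 < a - 2^-1 by lra.
rewrite !ln_div ?posrE // => h.
have := ler_wpM2l (ltW a1) h.
have -> : a * ((a + 2^-1) / a * (ln (a + 2^-1) - ln a) -
   (a - 2^-1) / a * (ln (a - 2^-1) - ln a)) =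
   (a + 2^-1) * (ln (a + 2^-1) - ln a) - (a - 2^-1) * (ln (a - 2^-1) - ln a).
  by field; rewrite gt_eqF.
have -> : a * (2 * (2 * a)^-1) = 1 by field; rewrite gt_eqF.
move: IHM; rewrite hM (_ : a - 1 + 2^-1 = a - 2^-1); last by lra.
lra.
Qed.

(** The convex function [b * ln b - b] is above its tangent at [y]. This moves
    Stirling's bounds from the integer [N %/ d] to the real number [N / d] without
    any loss in the main terms. *)
Lemma xlnx_tangent (R : realType) (b y : R) : 0 < b -> 0 < y ->
  b * ln y - y <= b * ln b - b.
Proof.
move=> b0 y0; have : ln (y / b) <= y / b - 1.
  have yb : 0 < y / b by rewrite divr_gt0.
  by rewrite -{1}(subrK 1 (y / b)) addrC le_ln1Dx //; lra.
rewrite ln_div ?posrE // => /(ler_wpM2l (ltW b0)).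
have -> : b * (y / b - 1) = y - b by field; rewrite gt_eqF.
lra.
Qed.

Lemma divn_bounds (R : realType) (N d : nat) : (0 < d)%N ->
  (N %/ d)%:R <= N%:R / d%:R :> R /\ N%:R / d%:R <= (N %/ d)%:R + 1 :> R.
Proof.
move=> d0; have d0R : 0 < d%:R :> R by rewrite ltr0n.
split; first by rewrite ler_pdivlMr // -natrM ler_nat leq_divM.
by rewrite ler_pdivrMr // natr1 -natrM ler_nat ltnW // ltn_ceil.
Qed.

Lemma ln_fact_div_le (R : realType) (N d : nat) : (0 < d <= N)%N ->
  ln ((N %/ d)`!%:R : R) <=
  N%:R / d%:R * (ln N%:R - ln d%:R) - N%:R / d%:R + (ln N%:R - ln d%:R) / 2 + 1.
Proof.
move=> /andP[d0 dN]; have [hM _] := divn_bounds R N _ d0.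
have N0 : (0 < N)%N by apply: leq_trans dN.
have M0 : (0 < N %/ d)%N by rewrite divn_gt0.
have := ln_fact_le R _ M0; set M : R := (N %/ d)%:R.
rewrite -ln_div ?posrE ?ltr0n //.
set y : R := N%:R / d%:R; rewrite -/M -/y in hM *.
have M1 : 1 <= M by rewrite ler1n.
have M0R : 0 < M by lra.
have y0 : 0 < y by lra.
have lnMy : ln M <= ln y by rewrite ler_ln ?posrE.
have lnM0 : 0 <= ln M by rewrite ln_ge0.
have := xlnx_tangent R _ _ y0 M0R.
have := ler_wpM2r lnM0 hM.
lra.
Qed.

Lemma ln_fact_div_ge (R : realType) (N d : nat) : (0 < d <= N)%N ->
  N%:R / d%:R * (ln N%:R - ln d%:R) - N%:R / d%:R - (ln N%:R - ln d%:R) / 2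
    + (1 + ln 2) / 2 <= ln ((N %/ d)`!%:R : R).
Proof.
move=> /andP[d0 dN]; have [_ hM] := divn_bounds R N _ d0.
have N0 : (0 < N)%N by apply: leq_trans dN.
have := ln_fact_ge R (N %/ d); set M : R := (N %/ d)%:R.
rewrite -ln_div ?posrE ?ltr0n //.
have y1 : 1 <= N%:R / d%:R :> R by rewrite ler_pdivlMr ?ltr0n // mul1r ler_nat.
set y : R := N%:R / d%:R in y1 *; rewrite -/M -/y in hM *.
have y0 : 0 < y by lra.
have b0 : 0 < M + 2^-1 by lra.
have lny : 0 <= ln y by rewrite ln_ge0.
have hb : y - 2^-1 <= M + 2^-1 by lra.
have := xlnx_tangent R _ _ b0 y0.
have := ler_wpM2r lny hb.
lra.
Qed.

(** * Chebyshev's inequality for signed weights *)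

(** The coefficient of [ln N`!] that cancels the terms in [N * ln N]. *)
Definition balance (R : realType) (pos neg : seq nat) : R :=
  \sum_(d <- neg) d%:R^-1 - \sum_(d <- pos) d%:R^-1.

(** Up to [T] the inequality is the integral one, since [balance] is at least
    [1]. Beyond [T] the balanced step function is a signed sum of fractional parts,
    hence at least [- size pos], and enough thresholds have been passed to make up
    for that. *)
Lemma step_function_ge (R : realType) (pos neg ks : seq nat) (T : nat) :
  all (leq 1) pos -> all (leq 1) neg ->
  1 <= balance R pos neg ->
  (size pos < count (fun k => k <= T)%N ks)%N ->
  (forall t, (0 < t < T)%N ->
     (1 + \sum_(d <- neg) t %/ d <=
      t + \sum_(d <- pos) t %/ d + count (fun k => k <= t)%N ks)%N) ->
  forall t, (0 < t)%N ->
  1 <= balance R pos neg * t%:R + \sum_(d <- pos) (t %/ d)%:R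
       - \sum_(d <- neg) (t %/ d)%:R + (count (fun k => k <= t)%N ks)%:R :> R.
Proof.
move=> /allP pos0 /allP neg0 c1 hks hF t t0.
have [tT|Tt] := ltnP t T.
  have := hF t; rewrite t0 tT => /(_ isT).
  rewrite -(ler_nat R) !natrD !natr_sum => h.
  have := ler_wpM2r (ler0n R t) c1; lra.
have hn : 0 <= \sum_(d <- neg) (d%:R^-1 * t%:R - (t %/ d)%:R) :> R.
  rewrite big_seq sumr_ge0 // => d /neg0 d0; rewrite subr_ge0 mulrC.
  by have [] := divn_bounds R t _ d0.
have hp : \sum_(d <- pos) (d%:R^-1 * t%:R - (t %/ d)%:R) <= (size pos)%:R :> R.
  rewrite -sum1_size natr_sum big_seq [leRHS]big_seq ler_sum // => d /pos0 d0.
  rewrite mulrC; have [] := divn_bounds R t _ d0; lra.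
have hk : (size pos)%:R + 1 <= (count (fun k => k <= t)%N ks)%:R :> R.
  rewrite natr1 ler_nat (leq_trans hks) // sub_count // => k /= kT.
  exact: leq_trans kT Tt.
rewrite !sumrB -!mulr_suml in hn hp; rewrite /balance mulrBl; lra.
Qed.

(** Chebyshev's inequality for the weights [1] on [pos] and [-1] on [neg], after
    Stirling's formula. The terms in [N * ln N] and in [N] cancel by the choice of
    [balance], which leaves a main term linear in [N] and an error logarithmic
    in [N]. *)
Lemma psi_le_step (R : realType) (N : nat) (pos neg ks : seq nat) :
  let b := balance R pos neg in
  let np : R := (size pos)%:R in
  let nn : R := (size neg)%:R in
  (0 < N)%N -> all (fun d => 0 < d <= N)%N pos -> all (fun d => 0 < d <= N)%N neg ->
  all (leq 1) ks -> 0 <= b ->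
  (forall t, (0 < t)%N ->
     1 <= b * t%:R + \sum_(d <- pos) (t %/ d)%:R - \sum_(d <- neg) (t %/ d)%:R
          + (count (fun k => k <= t)%N ks)%:R) ->
  psi R N <=
    N%:R * (\sum_(d <- neg) ln d%:R / d%:R - \sum_(d <- pos) ln d%:R / d%:R)
    + (b + np + nn) / 2 * ln N%:R
    - (\sum_(d <- pos) ln d%:R + \sum_(d <- neg) ln d%:R) / 2
    + (b + np) - nn * (1 + ln 2) / 2 + \sum_(k <- ks) psi R (N %/ k).
Proof.
move=> b np nn N0 /allP posN /allP negN ks0 b0 hF.
pose s : seq (nat * R) :=
  (1%N, b) :: [seq (d, 1) | d <- pos] ++ [seq (d, -1) | d <- neg].
have sE (F : nat -> R) : \sum_(x <- s) x.2 * F x.1 =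
    b * F 1%N + \sum_(d <- pos) F d - \sum_(d <- neg) F d.
  rewrite big_cons big_cat !big_map /= -addrA; congr (_ + (_ + _)).
    by apply: eq_bigr => d _; rewrite mul1r.
  by rewrite -sumrN; apply: eq_bigr => d _; rewrite mulN1r.
have := chebyshev_transfer R N s ks ks0.
rewrite (sE (fun d => ln (N %/ d)`!%:R)) => h.
apply: le_trans (h _) _ => [t t0|].
  by rewrite (sE (fun d => (t %/ d)%:R)) divn1 hF.
rewrite lerD2r divn1.
set l := ln N%:R; set n : R := N%:R.
have hb : b * ln N`!%:R <= b * (n * l - n + l / 2 + 1).
  rewrite ler_wpM2l //; have := ln_fact_div_le R N 1.
  by rewrite N0 divn1 ln1 subr0 divr1; apply.
have hp : \sum_(d <- pos) ln (N %/ d)`!%:R <=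
   \sum_(d <- pos) (d%:R^-1 * (n * l - n) + (- n * (ln d%:R / d%:R) +
      ((l / 2 + 1) + - 2^-1 * ln d%:R))).
  rewrite big_seq [leRHS]big_seq ler_sum // => d /posN dN.
  apply: le_trans (ln_fact_div_le R N _ dN) _; rewrite -/l -/n; lra.
have hn : \sum_(d <- neg) (d%:R^-1 * (n * l - n) + (- n * (ln d%:R / d%:R) +
      ((- (l / 2) + (1 + ln 2) / 2) + 2^-1 * ln d%:R))) <=
   \sum_(d <- neg) ln (N %/ d)`!%:R.
  rewrite big_seq [leRHS]big_seq ler_sum // => d /negN dN.
  apply: le_trans (ln_fact_div_ge R N _ dN); rewrite -/l -/n; lra.
have sumc (u : seq nat) (c : R) : \sum_(d <- u) c = (size u)%:R * c.
  elim: u => [|d u IHu]; first by rewrite big_nil mul0r.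
  by rewrite big_cons IHu /= -natr1 mulrDl mul1r addrC.
move: hp hn; rewrite !big_split /= -!mulr_sumr -!mulr_suml !sumc.
rewrite -/np -/nn; move: hb; rewrite /b /balance.
set A := \sum_(_ <- _) _; set B := \sum_(_ <- _) _; set C := \sum_(_ <- _) _.
lra.
Qed.

(** * Evaluation of step functions by countdowns *)

(** One step of a row of countdowns: the counter of [d] reaches [0] exactly at
    the multiples of [d], so no division is ever computed. *)
Fixpoint tick (l : seq (nat * nat)) : nat * seq (nat * nat) :=
  if l is (d, c) :: l' then
    let (h, r) := tick l' in
    if c is c'.+1 then (h, (d, c') :: r) else (h.+1, (d, d.-1) :: r)
  else (0%N, [::]).

Definition counters (t : nat) (ds : seq nat) : seq (nat * nat) :=
  [seq (d, d.-1 - t %% d)%N | d <- ds].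

Lemma counter_eq0 d t : (0 < d)%N -> (d.-1 - t %% d == 0)%N = (d %| t.+1)%N.
Proof.
move=> d0; have rd := ltn_pmod t d0.
rewrite {2}(divn_eq t d) -addnS dvdn_addr ?dvdn_mull // subn_eq0.
apply/idP/idP => [dr|/dvdn_leq]; last by lia.
by rewrite (_ : (t %% d).+1 = d) //; lia.
Qed.

Lemma tick_counters t ds : all (leq 1) ds ->
  tick (counters t ds) = (count (fun d => d %| t.+1)%N ds, counters t.+1 ds).
Proof.
elim: ds => [//|d ds IHds] /= /andP[d0 /IHds ->].
have := counter_eq0 d t d0; have := ltn_pmod t d0; rewrite modnS.
case E: (d.-1 - t %% d)%N => [|c] td <- /=; first by rewrite subn0.
by congr (_, (_, _) :: _); lia.
Qed.

(** The accumulator [g] is [t] plus the step functions of [pos] and of the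
    thresholds minus that of [neg], and has to stay positive. A threshold [k] is
    represented by its distance [k - t], and is passed when this is [1]. *)
Fixpoint check_steps (n : nat) (pos neg : seq (nat * nat)) (ks : seq nat) (g : nat) :=
  if n is n'.+1 then
    let (u, pos') := tick pos in
    let (v, neg') := tick neg in
    let g' := (g.+1 + u + count (pred1 1) ks)%N in
    (v < g')%N && check_steps n' pos' neg' (map predn ks) (g' - v)%N
  else true.

Lemma check_stepsP n pos neg ks t g : all (leq 1) pos -> all (leq 1) neg ->
  (g + \sum_(d <- neg) t %/ d =
   t + \sum_(d <- pos) t %/ d + count (fun k => k <= t) ks)%N ->
  check_steps n (counters t pos) (counters t neg) [seq k - t | k <- ks]%N g ->
  forall t', (t < t' <= t + n)%N ->
  (1 + \sum_(d <- neg) t' %/ d <=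
   t' + \sum_(d <- pos) t' %/ d + count (fun k => k <= t') ks)%N.
Proof.
move=> pos0 neg0; elim: n t g => [|n IHn] t g gE; first by move=> _ t'; lia.
have sumS ds : all (leq 1) ds -> (\sum_(d <- ds) t.+1 %/ d =
    count (fun d => d %| t.+1) ds + \sum_(d <- ds) t %/ d)%N.
  move=> /allP ds0; rewrite -sum1_count [in RHS]big_mkcond -big_split /=.
  by apply: eq_big_seq => d /ds0 d0; rewrite divnS //; case: (d %| _)%N.
have cntS : (count (fun k => k <= t.+1) ks =
    count (pred1 1) [seq k - t | k <- ks] + count (fun k => k <= t) ks)%N.
  elim: ks {gE IHn} => //= k ks ->; rewrite [RHS]addnACA; congr addn; lia.
rewrite /= !tick_counters //; set g' := (g.+1 + _ + _)%N => /andP[vg'].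
rewrite -map_comp (@eq_map _ _ _ (fun k => k - t.+1)%N) => [|k /=]; last by lia.
have g'E : (g' - count (fun d => d %| t.+1) neg + \sum_(d <- neg) t.+1 %/ d =
   t.+1 + \sum_(d <- pos) t.+1 %/ d + count (fun k => k <= t.+1) ks)%N.
  have arith a b c v x y z w : (v < a.+1 + b + c -> a + x = y + z + w ->
      a.+1 + b + c - v + (v + x) = y.+1 + (b + z) + (c + w))%N by lia.
  by rewrite !sumS // cntS; apply: arith.
move=> /(IHn _ _ g'E) h t' /andP[]; rewrite leq_eqVlt => /orP[/eqP<- _|tt' tn].
  by rewrite -g'E; lia.
by apply: h; rewrite tt' addSnnS.
Qed.

Lemma check_steps0P n pos neg ks :
  all (leq 1) pos -> all (leq 1) neg -> all (leq 1) ks ->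
  check_steps n (counters 0 pos) (counters 0 neg) ks 0 ->
  forall t, (0 < t <= n)%N ->
  (1 + \sum_(d <- neg) t %/ d <=
   t + \sum_(d <- pos) t %/ d + count (fun k => k <= t) ks)%N.
Proof.
move=> pos0 neg0 ks0 h; apply: (check_stepsP n pos neg ks 0 0) => //.
  rewrite !big1 ?add0n => [|d _|d _]; rewrite ?div0n //.
  by rewrite (eq_in_count (a2 := pred0)) ?count_pred0 // => k /(allP ks0) /=; case: k.
by rewrite (eq_map subn0) map_id.
Qed.

(** * The weights *)

(** Signs for a Chebyshev inequality, obtained from a linear program for the best
    constant followed by a randomized search among integral weights. Below [20] the
    weight of [d] is the Moebius function, which makes the step function equal to
    [1] up to there; the other weights keep it from falling far below [1] later.
    The repeated [30] has weight [-2]. *)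
Definition cheb_pos : seq nat :=
  [:: 6; 10; 14; 15; 21; 22; 26; 34; 35; 39; 46; 55; 57; 84; 89; 94; 95].
Definition cheb_neg : seq nat :=
  [:: 2; 3; 5; 7; 11; 13; 17; 19; 23; 30; 30; 41; 42; 44; 47; 56; 70; 78; 101; 111].
(** The step function of the weights is at least [1] before [51], at least [0]
    before [153], and so on; each drop is paid for by a term [psi (N %/ k)]. Beyond
    [cheb_range] only the trivial lower bound [- size cheb_pos] is used, and the
    last threshold is repeated accordingly. *)
Definition cheb_range : nat := (16 * 1024)%N.
Definition cheb_thresholds : seq nat :=
  [:: 51; 153; 1235; 1419] ++ nseq 14 cheb_range.

Lemma cheb_steps_check :
  check_steps cheb_range (counters 0 cheb_pos) (counters 0 cheb_neg) cheb_thresholds 0.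
Proof. by vm_cast_no_check (erefl true). Qed.

Lemma cheb_steps t : (0 < t < cheb_range)%N ->
  (1 + \sum_(d <- cheb_neg) t %/ d <=
   t + \sum_(d <- cheb_pos) t %/ d + count (fun k => k <= t) cheb_thresholds)%N.
Proof.
move=> /andP[t0 tT].
apply: (check_steps0P _ _ _ _ _ _ _ cheb_steps_check) => //.
by rewrite t0 ltnW.
Qed.

Lemma to_nat_expn (a b : N) : N.to_nat (N.pow a b) = (N.to_nat a ^ N.to_nat b)%N.
Proof.
rewrite N2Nat.inj_pow; elim: (N.to_nat b) => [//|k IHk] /=.
by rewrite IHk expnS.
Qed.

Lemma expn_leq_bin (a b c d : nat) :
  N.leb (N.pow (N.of_nat a) (N.of_nat b)) (N.pow (N.of_nat c) (N.of_nat d)) -> (a ^ b <= c ^ d)%N.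
Proof.
move/N.leb_le => h; have {}h : (N.to_nat (N.pow (N.of_nat a) (N.of_nat b)) <=
  N.to_nat (N.pow (N.of_nat c) (N.of_nat d)))%N by lia.
by move: h; rewrite !to_nat_expn !Nat2N.id.
Qed.

Lemma ln_expn (R : realType) (a b : nat) : (0 < a)%N ->
  ln ((a ^ b)%N%:R : R) = b%:R * ln a%:R.
Proof. by move=> a0; rewrite natrX lnXn ?ltr0n // mulr_natl. Qed.

Lemma ln_ge_bits (R : realType) (d q a : nat) : (0 < d)%N ->
  N.leb (N.pow (N.of_nat 2) (N.of_nat a)) (N.pow (N.of_nat d) (N.of_nat q)) ->
  a%:R * ln 2 <= q%:R * ln d%:R :> R.
Proof.
move=> d0 /(expn_leq_bin 2) h.
by rewrite -!ln_expn // ler_ln ?posrE ?ltr0n ?expn_gt0 ?d0 // ler_nat.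
Qed.

Lemma ln_le_bits (R : realType) (d q a : nat) : (0 < d)%N ->
  N.leb (N.pow (N.of_nat d) (N.of_nat q)) (N.pow (N.of_nat 2) (N.of_nat a)) ->
  q%:R * ln d%:R <= a%:R * ln 2 :> R.
Proof.
move=> d0 /(expn_leq_bin _ _ 2) h.
by rewrite -!ln_expn // ler_ln ?posrE ?ltr0n ?expn_gt0 ?d0 // ler_nat.
Qed.

(** Logarithms are measured in units of [ln 2]: the proof compares, for each [d],
    a power of [d] with a power of [2], which places [log2 d] close to a fraction
    [a / q], on the side of it that the sign of the weight requires. *)
Lemma cheb_slope (R : realType) :
  \sum_(d <- cheb_neg) ln d%:R / d%:R - \sum_(d <- cheb_pos) ln d%:R / d%:R
  <= 1447 / 1000 * ln 2 :> R.
Proof.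
have ge d q a := @ln_ge_bits R d q a; have le d q a := @ln_le_bits R d q a.
have := ge 6 53 137 erefl erefl; have := ge 10 87 289 erefl erefl.
have := ge 14 57 217 erefl erefl; have := ge 15 75 293 erefl erefl.
have := ge 21 51 224 erefl erefl; have := ge 22 61 272 erefl erefl.
have := ge 26 10 47 erefl erefl; have := ge 34 23 117 erefl erefl.
have := ge 35 31 159 erefl erefl; have := ge 39 81 428 erefl erefl.
have := ge 46 23 127 erefl erefl; have := ge 55 32 185 erefl erefl.
have := ge 57 65 379 erefl erefl; have := ge 84 23 147 erefl erefl.
have := ge 89 19 123 erefl erefl; have := ge 94 29 190 erefl erefl.
have := ge 95 30 197 erefl erefl.
have := le 3 94 149 erefl erefl; have := le 5 59 137 erefl erefl.
have := le 7 26 73 erefl erefl; have := le 11 37 128 erefl erefl.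
have := le 13 97 359 erefl erefl; have := le 17 57 233 erefl erefl.
have := le 19 4 17 erefl erefl; have := le 23 21 95 erefl erefl.
have := le 30 43 211 erefl erefl; have := le 41 39 209 erefl erefl.
have := le 42 28 151 erefl erefl; have := le 44 37 202 erefl erefl.
have := le 47 9 50 erefl erefl; have := le 56 21 122 erefl erefl.
have := le 70 23 141 erefl erefl; have := le 78 7 44 erefl erefl.
have := le 101 41 273 erefl erefl; have := le 111 39 265 erefl erefl.
have l2 : 0 < ln 2 :> R by rewrite ln_gt0 // ltr1n.
rewrite !big_cons !big_nil.
lra.
Qed.

Lemma ln2_bounds (R : realType) : (2 / 3 : R) <= ln (2 : R) <= 1.
Proof.
apply/andP; split.
  have v : (0 : R) <= (3 : R)^-1 < 1 by apply/andP; split; lra.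
  have h1 : 0 < 1 + 3^-1 :> R by lra.
  have h2 : 0 < 1 - 3^-1 :> R by lra.
  have := ln_odds_ge R _ v; rewrite -ln_div ?posrE //.
  rewrite (_ : (1 + 3^-1) / (1 - 3^-1) = 2); last by field.
  lra.
have := @le_ln1Dx R 1 _; rewrite (_ : 1 + 1 = 2); last by lra.
by apply; lra.
Qed.

Lemma sum_ln_ge_bits (R : realType) (ds : seq nat) : all (leq 1) ds ->
  (\sum_(d <- ds) trunc_log 2 d)%N%:R * ln 2 <= \sum_(d <- ds) ln d%:R :> R.
Proof.
move=> /allP ds0; rewrite natr_sum mulr_suml big_seq [leRHS]big_seq.
apply: ler_sum => d /ds0 d0; rewrite -ln_expn // ler_ln ?posrE ?ltr0n ?expn_gt0 //.
by rewrite ler_nat trunc_logP.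
Qed.

Lemma cheb_balance (R : realType) : 1 <= balance R cheb_pos cheb_neg <= 11 / 10.
Proof. by rewrite /balance /cheb_pos /cheb_neg !big_cons !big_nil; lra. Qed.

Lemma cheb_tail :
  (size cheb_pos < count (fun k => k <= cheb_range) cheb_thresholds)%N.
Proof.
have h k : (k <= 2 * 1024)%N -> (k <= cheb_range)%N.
  by move=> h; apply: leq_trans h _; rewrite leq_mul2r.
rewrite /cheb_thresholds count_cat count_nseq leqnn mul1n.
suff /eqP -> : count (fun k => k <= cheb_range)%N [:: 51; 153; 1235; 1419]%N == 4%N by [].
rewrite -[4%N]/(size [:: 51; 153; 1235; 1419]%N) -all_count.
by apply/allP => k hk; apply: h; move: k hk; apply/allP.
Qed.

(** The induction step, in units of [ln 2]. The slope [1447 / 1000] of the main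
    term, increased by [3 / 2] times the sum of the reciprocals of the thresholds,
    which is below [1 / 35], stays under [3 / 2], and from [20 * 1024] on the gap
    covers the logarithmic error. *)
Lemma psi_le_large (R : realType) (N : nat) : (20 * 1024 <= N)%N ->
  (forall M, (M < N)%N -> psi R M <= 3 / 2 * ln 2 * M%:R) ->
  psi R N <= 3 / 2 * ln 2 * N%:R.
Proof.
move=> XN IH; have /andP[b1 b2] := cheb_balance R.
have N0 : (0 < N)%N by apply: leq_trans XN.
have ks0 : all (leq 1) cheb_thresholds by [].
have dN ds : all (fun d => 0 < d <= 200)%N ds -> all (fun d => 0 < d <= N)%N ds.
  apply: sub_all => d /andP[-> h] /=; apply: leq_trans h (leq_trans _ XN).
  by [].
have b0 : 0 <= balance R cheb_pos cheb_neg by lra.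
have := psi_le_step R N cheb_pos cheb_neg cheb_thresholds N0 (dN cheb_pos isT)
  (dN cheb_neg isT) ks0 b0.
move=> /(_ (step_function_ge R cheb_pos cheb_neg cheb_thresholds cheb_range
  isT isT b1 cheb_tail cheb_steps)).
have hks : \sum_(k <- cheb_thresholds) psi R (N %/ k) <=
    3 / 2 * ln 2 * N%:R / 35.
  apply: (@le_trans _ _ (\sum_(k <- cheb_thresholds) 3 / 2 * ln 2 * N%:R * k%:R^-1)).
    rewrite big_seq [leRHS]big_seq; apply: ler_sum => k hk.
    have k2 : (1 < k)%N by move: k hk; apply/allP.
    apply: le_trans (IH _ (ltn_Pdiv k2 N0)) _.
    rewrite -[leRHS]mulrA; apply: ler_wpM2l.
      by have /andP[] := ln2_bounds R; lra.
    by have [] := divn_bounds R N k (ltnW k2).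
  rewrite -mulr_sumr; apply: ler_wpM2l.
    by rewrite !mulr_ge0 ?ler0n // ln_ge0 // ler1n.
  rewrite /cheb_thresholds /cheb_range big_cat big_nseq !big_cons big_nil.
  rewrite iter_addr_0 natrM invfM /=; lra.
pose K : R := N%:R / 1024.
have NK : N%:R = 1024 * K by rewrite /K; field.
have K20 : 20 <= K by rewrite ler_pdivlMr ?ltr0n // -natrM ler_nat.
(* The tangent to [ln] at [2 ^ 14], a point close to the least value of [N]. *)
have hl : ln N%:R <= 14 * ln 2 + K / 16 - 1 :> R.
  have h14 : 14 * ln 2 = ln (2 ^+ 14) :> R by rewrite lnXn // mulr_natl.
  have p14 : 0 < 2 ^+ 14 :> R by rewrite exprn_gt0.
  have := xlnx_tangent R _ N%:R p14; rewrite ltr0n => /(_ N0).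
  rewrite -h14 NK (_ : 2 ^+ 14 = 1024 * 16 :> R); last by lra.
  lra.
have hp := sum_ln_ge_bits R cheb_pos isT; have hn := sum_ln_ge_bits R cheb_neg isT.
have hbits : (\sum_(d <- cheb_pos) trunc_log 2 d + \sum_(d <- cheb_neg) trunc_log 2 d
    = 158)%N by rewrite !big_cons !big_nil.
have {hp hn}hd : 158 * ln 2 <= \sum_(d <- cheb_pos) ln d%:R + \sum_(d <- cheb_neg) ln d%:R :> R.
  by rewrite -hbits natrD mulrDl lerD.
have hs := cheb_slope R; have /andP[l1 l2] := ln2_bounds R.
set b := balance R _ _ in b1 b2 b0 *.
rewrite [size cheb_pos]/= [size cheb_neg]/=.
have hN := ler_wpM2l (ler0n R N) hs.
have l0 : 0 <= ln N%:R :> R by rewrite ln_ge0 // ler1n.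
have hbl : (b + 17 + 20) / 2 * ln N%:R <= (381 / 20) * (14 * ln 2 + K / 16 - 1).
  have := ler_wpM2r l0 b2; lra.
have hKL : 0 <= (K - 20) * (ln 2 - 2 / 3) by rewrite mulr_ge0; lra.
move: hN hks hbl; rewrite NK => hN hks hbl hpsi.
lra.
Qed.

(** * A sieve for the small cases *)

(** An entry [(p, c, w)] of the sieve at time [t]: [c] counts down to the next
    multiple of [p], and [w] is the least power of [p] above [t]. *)
Definition sieve_entry (t : nat) (x : nat * nat * N) : Prop :=
  [/\ prime x.1.1, x.1.2 = (x.1.1.-1 - t %% x.1.1)%N &
      exists j, N.to_nat x.2 = (x.1.1 ^ j.+1)%N /\ (x.1.1 ^ j <= t < x.1.1 ^ j.+1)%N].

(** The first component bounds the factor that the lcm gains at [k]: [1] if some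
    [p] of the list divides [k] and [k] is no power of [p], [p] if [k] is a power
    of [p], and [k] itself if no [p] divides it. The list may be incomplete: that
    only makes the bound worse. *)
Fixpoint sieve_tick (k : N) (l : seq (nat * nat * N)) : N * seq (nat * nat * N) :=
  if l is (p, c, w) :: l' then
    let (f, r) := sieve_tick k l' in
    if c is c'.+1 then (f, (p, c', w) :: r)
    else if N.eqb k w then (N.of_nat p, (p, p.-1, N.mul w (N.of_nat p)) :: r)
    else (1%num, (p, p.-1, w) :: r)
  else (k, [::]).

Lemma lcm_upto_power_step p j t : t.+1 = (p ^ j.+1)%N -> (p ^ j <= t)%N ->
  (0 < p)%N -> (lcm_upto t.+1 %| p * lcm_upto t)%N.
Proof.
move=> tE jt p0; rewrite lcm_uptoS dvdn_lcm dvdn_mull //= tE expnS dvdn_mul //.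
by rewrite dvdn_lcm_upto // expn_gt0 p0.
Qed.

(** Such a [t.+1] is a product of coprime factors that are both at most [t]. *)
Lemma lcm_upto_nonpower_step p j t : prime p -> (p %| t.+1)%N ->
  (p ^ j <= t < p ^ j.+1)%N -> t.+1 <> (p ^ j.+1)%N ->
  (lcm_upto t.+1 %| lcm_upto t)%N.
Proof.
move=> pp pt /andP[jt tj] tN; rewrite lcm_uptoS dvdn_lcm dvdnn /=.
have p1 := prime_gt1 pp.
have [m pm tE] := pfactor_coprime pp (ltn0Sn t).
set e := logn p t.+1 in tE.
have e0 : (0 < e)%N by rewrite /e logn_gt0 mem_primes pp /=.
have pe : (1 < p ^ e)%N by rewrite -(exp1n e) ltn_exp2r.
have m1 : (1 < m)%N.
  rewrite ltnNge; apply/negP => m1; apply: tN.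
  have m1E : m = 1%N by case: m m1 tE {pm} => [|[|m]].
  move: tE; rewrite m1E mul1n => tE.
  suff -> : j.+1 = e by [].
  have je : (j < e)%N by rewrite -(ltn_exp2l _ _ p1) -tE ltnS.
  have ej : (e <= j.+1)%N by rewrite -(leq_exp2l _ _ p1) -tE.
  by apply/eqP; rewrite eqn_leq je.
rewrite tE Gauss_dvd; last by rewrite coprime_sym coprime_pexpl.
by rewrite !dvdn_lcm_upto //; nia.
Qed.

Lemma sieve_tickP t (k : N) l : N.to_nat k = t.+1 -> (0 < t)%N ->
  (forall x, x \in l -> sieve_entry t x) ->
  [/\ (0 < N.to_nat (sieve_tick k l).1)%N,
      (lcm_upto t.+1 %| N.to_nat (sieve_tick k l).1 * lcm_upto t)%N &
      forall x, x \in (sieve_tick k l).2 -> sieve_entry t.+1 x].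
Proof.
move=> kE t0; elim: l => [|[[p c] w] l IHl] hl.
  by split=> //=; rewrite kE // lcm_uptoS dvdn_lcm dvdn_mull // dvdn_mulr.
have [|f0 fd hr] := IHl; first by move=> x xl; apply: hl; rewrite inE xl orbT.
have [/= pp cE [j [wE /andP[jt tj]]]] := hl _ (mem_head _ _).
have p0 := prime_gt0 pp; have p1 := prime_gt1 pp.
have hit := counter_eq0 p t p0; have tp := ltn_pmod t p0.
have tS := modnS t p.
case: (sieve_tick k l) f0 fd hr => f r /= f0 fd hr.
case: c cE {hl IHl} => [|c] cE; rewrite -cE /= in hit; rewrite -hit in tS.
  case: N.eqb_spec => [kw|kw] /=.
    have tE : t.+1 = (p ^ j.+1)%N by rewrite -kE kw.
    rewrite Nat2N.id; split=> //; first exact: lcm_upto_power_step tE jt p0.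
    move=> x; rewrite inE => /predU1P[->|/hr //]; split=> //=.
      by rewrite tS subn0.
    exists j.+1; rewrite N2Nat.inj_mul Nat2N.id wE multE -expnSr tE leqnn.
    by split; rewrite ?ltn_exp2l //=.
  have tN : t.+1 <> (p ^ j.+1)%N.
    by move=> tE; apply: kw; apply: N2Nat.inj; rewrite kE wE.
  split=> //; first by rewrite mul1n (lcm_upto_nonpower_step p j) // jt.
  move=> x; rewrite inE => /predU1P[->|/hr //]; split=> //=.
    by rewrite tS subn0.
  exists j; rewrite wE; split=> //; rewrite (leqW jt) ltn_neqAle /=.
  by apply/andP; split=> //; apply/eqP.
split=> // x; rewrite inE => /predU1P[->|/hr //]; split=> //=.
  by rewrite tS /=; lia.
exists j; split=> //; rewrite (leqW jt) ltn_neqAle /=; apply/andP; split=> //; apply/eqP => tE.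
by move: hit; rewrite tE expnS dvdn_mulr.
Qed.

(** An upper bound for the lcm is kept in floating point, as a short mantissa
    [P] and an exponent [e], so that the multiplications stay cheap. *)
Definition float_up (P e : N) : N * N :=
  if N.ltb P (N.pow 2 40) then (P, e)
  else (N.succ (N.shiftr P 20), N.add e 20).

(** The first test compares bit lengths and suffices except at [k = 31] and
    [k = 113]; the second one is exact. *)
Definition float_check (k P e : N) : bool :=
  if N.leb (N.mul 2 (N.add e (N.size P))) (N.mul 3 k) then true
  else N.leb (N.mul (N.mul P P) (N.pow 4 e)) (N.pow 8 k).

Fixpoint sieve_check (n : nat) (k P e : N) (l : seq (nat * nat * N)) : bool :=
  if n is n'.+1 then
    let (f, l') := sieve_tick k l in
    if N.eqb f 1 then sieve_check n' (N.succ k) P e l'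
    else let (P', e') := float_up (N.mul P f) e in
      float_check k P' e' && sieve_check n' (N.succ k) P' e' l'
  else true.

Lemma to_nat_leq (a b : N) : N.leb a b -> (N.to_nat a <= N.to_nat b)%N.
Proof. by move/N.leb_le => h; lia. Qed.

Lemma float_upP (P e : N) (x : nat) : (x <= N.to_nat P * 2 ^ N.to_nat e)%N ->
  (x <= N.to_nat (float_up P e).1 * 2 ^ N.to_nat (float_up P e).2)%N.
Proof.
rewrite /float_up; case: ifP => // _ /leq_trans; apply; cbn [fst snd].
rewrite N2Nat.inj_add (_ : N.to_nat 20 = 20) // plusE expnD [(2 ^ _ * _)%N]mulnC mulnA.
rewrite leq_mul2r; apply/orP; right.
have -> : (2 ^ 20)%N = N.to_nat (N.pow 2 20) by rewrite to_nat_expn.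
rewrite N.shiftr_div_pow2 -multE -N2Nat.inj_mul.
apply: to_nat_leq; apply/N.leb_le.
have h := N.div_mod' P (N.pow 2 20); have h2 := N.mod_upper_bound P (N.pow 2 20).
have {}h2 : N.lt (N.modulo P (N.pow 2 20)) (N.pow 2 20) by apply: h2.
lia.
Qed.

Lemma float_checkP (k P e : N) (x : nat) : (x <= N.to_nat P * 2 ^ N.to_nat e)%N ->
  float_check k P e -> (x ^ 2 <= 8 ^ N.to_nat k)%N.
Proof.
rewrite /float_check => xP; case: ifP => [h _|_ h].
  have Ps : (N.to_nat P < 2 ^ N.to_nat (N.size P))%N.
    have hs := N.size_gt P; rewrite -[2%N]/(N.to_nat 2) -to_nat_expn; lia.
  have {h} h := to_nat_leq _ _ h.
  have {}h : (2 * (N.to_nat e + N.to_nat (N.size P)) <= 3 * N.to_nat k)%N by lia.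
  rewrite -[8%N]/(2 ^ 3)%N -expnM; apply: leq_trans (leq_pexp2l _ h) => //.
  rewrite mulnC expnM leq_exp2r // (leq_trans xP) // expnD mulnC leq_mul2l (ltnW Ps) orbT //.
have {h} := to_nat_leq _ _ h.
rewrite !N2Nat.inj_mul !to_nat_expn !multE => h; apply: leq_trans h.
rewrite -(leq_exp2r _ _ (isT : 0 < 2)%N) expnMn in xP.
by rewrite (leq_trans xP) // mulnn -[N.to_nat 4]/(2 ^ 2)%N -!expnM [(2 * N.to_nat e)%N]mulnC.
Qed.

(** The inequality is tested only at the [k] where the lcm may grow; between two
    of them the right-hand side increases. *)
Lemma sieve_checkP n t k P e l : N.to_nat k = t.+1 -> (0 < t)%N ->
  (forall x, x \in l -> sieve_entry t x) ->
  (lcm_upto t <= N.to_nat P * 2 ^ N.to_nat e)%N -> (lcm_upto t ^ 2 <= 8 ^ t)%N ->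
  sieve_check n k P e l ->
  forall m, (t <= m <= t + n)%N -> (lcm_upto m ^ 2 <= 8 ^ m)%N.
Proof.
elim: n t k P e l => [|n IHn] t k P e l kE t0 hl hP ht.
  by move=> _ m; rewrite addn0 -eqn_leq => /eqP <-.
have [/=] := sieve_tickP t k l kE t0 hl.
case: (sieve_tick k l) => f l' /= f0 fd hl'.
have kE' : N.to_nat (N.succ k) = t.+2 by lia.
have next P' e' : (lcm_upto t.+1 <= N.to_nat P' * 2 ^ N.to_nat e')%N ->
    (lcm_upto t.+1 ^ 2 <= 8 ^ t.+1)%N -> sieve_check n (N.succ k) P' e' l' ->
    forall m, (t <= m <= t + n.+1)%N -> (lcm_upto m ^ 2 <= 8 ^ m)%N.
  move=> hP' ht' hc m /andP[]; rewrite leq_eqVlt => /predU1P[<- //|tm mn].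
  by apply: (IHn _ _ _ _ _ kE' _ hl' hP' ht' hc); rewrite // tm addSnnS.
case: N.eqb_spec => [f1|_].
  have le : (lcm_upto t.+1 <= lcm_upto t)%N.
    by move: fd; rewrite f1 mul1n => /dvdn_leq; apply; apply: lcm_upto_gt0.
  apply: next; first exact: leq_trans hP.
  apply: leq_trans (leq_trans ht _); first by rewrite leq_exp2r.
  by rewrite leq_exp2l.
have hP' : (lcm_upto t.+1 <= N.to_nat (N.mul P f) * 2 ^ N.to_nat e)%N.
  rewrite N2Nat.inj_mul multE [(N.to_nat P * _)%N]mulnC -mulnA.
  apply: leq_trans (dvdn_leq _ fd) _; first by rewrite muln_gt0 f0 lcm_upto_gt0.
  by rewrite leq_mul2l hP orbT.
have := float_upP _ _ _ hP'; case: float_up => P' e' /= {}hP' /andP[hc].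
by apply: next => //; have := float_checkP k _ _ _ hP' hc; rewrite kE.
Qed.

Definition small_primes : seq nat :=
  [:: 2; 3; 5; 7; 11; 13; 17; 19; 23; 29; 31; 37; 41; 43; 47; 53; 59; 61; 67; 71;
      73; 79; 83; 89; 97; 101; 103; 107; 109; 113; 127; 131; 137; 139; 149].

(** The counters start at time [1], where the counter of [p] is [p.-1 - 1]. *)
Definition sieve_start : seq (nat * nat * N) :=
  [seq (p, p.-2, N.of_nat p) | p <- small_primes].

Lemma sieve_check_small : sieve_check (20 * 1024) 2 1 0 sieve_start.
Proof. by vm_cast_no_check (erefl true). Qed.

Lemma lcm_upto_sq_le_small m : (m <= 20 * 1024)%N -> (lcm_upto m ^ 2 <= 8 ^ m)%N.
Proof.
case: m => [|m] mX; first by rewrite /lcm_upto big_geq.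
have l1 : lcm_upto 1 = 1%N by rewrite /lcm_upto big_nat1.
apply: (sieve_checkP _ 1 2 1 0 sieve_start _ _ _ _ _ sieve_check_small) => //.
- move=> x /mapP[p pin ->]; have pp : prime p.
    by move: p pin; apply/allP; vm_compute.
  split=> //=.
    by rewrite modn_small ?prime_gt1 //; lia.
  by exists 0%N; rewrite Nat2N.id expn1 expn0 prime_gt1.
- by rewrite l1.
- by rewrite l1.
- by rewrite (leq_trans mX) // leq_addl.
Qed.

(** * The upper bound for the Chebyshev function *)

Lemma psi_le_of_lcm (R : realType) m : (lcm_upto m ^ 2 <= 8 ^ m)%N ->
  psi R m <= 3 / 2 * ln 2 * m%:R.
Proof.
move=> h; have {h}: ln (lcm_upto m ^ 2)%N%:R <= ln (8 ^ m)%N%:R :> R.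
  by rewrite ler_ln ?posrE ?ltr0n ?expn_gt0 ?lcm_upto_gt0 // ler_nat.
rewrite !ln_expn ?lcm_upto_gt0 // -/(psi R m).
by rewrite -[8%N]/(2 ^ 3)%N ln_expn //; lra.
Qed.

(** The constant is sharp for the application: the error term of the
    approximation to [euler_gamma] has size [16 ^- n], so that a saving of [2 ^- n]
    requires [psi (2 * n)] to be at most [n * ln 8] up to a logarithm. It is
    [1.0397...], and as [psi 113 / 113] is [1.0388...] there is little room. *)
Lemma psi_le (R : realType) m : psi R m <= 3 / 2 * ln 2 * m%:R.
Proof.
elim/ltn_ind: m => m IHm.
have small := lcm_upto_sq_le_small m; have large := psi_le_large R m.
move: (20 * 1024)%N small large => X small large.
have [mX|Xm] := leqP m X; first exact: psi_le_of_lcm (small mX).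
exact: large (ltnW Xm) IHm.
Qed.

Lemma lcm_upto_double_le (R : realType) n : (lcm_upto (2 * n))%:R <= 8 ^+ n :> R.
Proof.
rewrite -ler_ln ?posrE ?ltr0n ?lcm_upto_gt0 ?exprn_gt0 //.
apply: le_trans (psi_le R (2 * n)) _.
have ln8 : ln 8 = 3 * ln 2 :> R.
  by rewrite (_ : 8 = 2 ^+ 3); [rewrite lnXn // mulr_natl|lra].
by rewrite lnXn // ln8 natrM -[_ *+ n]mulr_natr; lra.
Qed.

(** * Partial fractions with simple poles *)

Definition harmonic_sum (R : realType) (n : nat) : R := \sum_(1 <= k < n.+1) k%:R^-1.

Definition alt_bin (R : realType) (n j : nat) : R := (-1) ^+ j * 'C(n, j)%:R.

(** The partial fraction form of [n`! / (t * (t + 1) * ... * (t + n))]. At a pole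
    [t = - i] the convention [0^-1 = 0] drops the singular term, which leaves the
    constant term of the Laurent expansion there. *)
Definition frac_sum (R : realType) (n : nat) (t : R) : R :=
  \sum_(j < n.+1) alt_bin R n j / (t + j%:R).

Definition rising (R : realType) (m : nat) (t : R) : R := \prod_(i < m) (t + i%:R).

Lemma harmonic_sumS (R : realType) n :
  harmonic_sum R n.+1 = harmonic_sum R n + n.+1%:R^-1.
Proof. by rewrite /harmonic_sum big_nat_recr. Qed.

Lemma alt_bin0 (R : realType) n : alt_bin R n 0 = 1.
Proof. by rewrite /alt_bin bin0 mul1r. Qed.

Lemma alt_binS (R : realType) n j :
  alt_bin R n.+1 j.+1 = alt_bin R n j.+1 - alt_bin R n j.
Proof. by rewrite /alt_bin binS natrD exprS; ring. Qed.

Lemma alt_bin_small (R : realType) n j : (n < j)%N -> alt_bin R n j = 0.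
Proof. by move=> nj; rewrite /alt_bin bin_small // mulr0. Qed.

(** Pascal's rule. *)
Lemma frac_sumS (R : realType) n (t : R) :
  frac_sum R n.+1 t = frac_sum R n t - frac_sum R n (t + 1).
Proof.
rewrite /frac_sum big_ord_recl (eq_bigr (fun j : 'I_n.+1 =>
  alt_bin R n j.+1 / (t + j.+1%:R) - alt_bin R n j / (t + 1 + j%:R))) => [|j _].
  rewrite sumrB addrA; congr (_ - _).
  rewrite [RHS]big_ord_recl /= !alt_bin0 big_ord_recr /= alt_bin_small // mul0r !addr0.
  by congr (_ + _); apply: eq_bigr => j _; rewrite lift0.
by rewrite lift0 alt_binS mulrBl -[t + 1 + _]addrA nat1r.
Qed.

Lemma risingS (R : realType) m (t : R) : rising R m.+1 t = rising R m t * (t + m%:R).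
Proof. by rewrite /rising big_ord_recr. Qed.

Lemma risingSl (R : realType) m (t : R) : rising R m.+1 t = t * rising R m (t + 1).
Proof.
rewrite /rising big_ord_recl addr0; congr (_ * _).
by apply: eq_bigr => i _; rewrite lift0 -nat1r addrA.
Qed.

Lemma frac_sumE (R : realType) n (t : R) : (forall j, (j <= n)%N -> t + j%:R != 0) ->
  frac_sum R n t = n`!%:R / rising R n.+1 t.
Proof.
elim: n t => [|n IHn] t ht.
  by rewrite /frac_sum /rising !big_ord1 alt_bin0.
rewrite frac_sumS !IHn; last 2 first.
- by move=> j jn; rewrite -addrA nat1r ht.
- by move=> j jn; rewrite ht // leqW.
have t0 : t != 0 by have := ht 0%N isT; rewrite addr0.
have tn := ht n.+1 (leqnn _).
have r0 : rising R n (t + 1) != 0.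
  apply/prodf_neq0 => i _; rewrite -addrA nat1r ht //.
  by rewrite ltnW // ltnS ltn_ord.
rewrite [rising R n.+1 t]risingSl [rising R n.+2 t]risingSl.
rewrite [rising R n.+1 (t + 1)]risingS -addrA nat1r factS natrM.
rewrite -nat1r in tn *.
by field; rewrite r0 tn t0.
Qed.

Lemma rising_fact (R : realType) m k :
  rising R m k.+1%:R * k`!%:R = (k + m)`!%:R.
Proof.
elim: m => [|m IHm]; first by rewrite /rising big_ord0 mul1r addn0.
by rewrite risingS mulrAC IHm addnS factS natrM mulrC -addSn natrD.
Qed.

Lemma rising_opp (R : realType) m : rising R m (- m%:R) = (-1) ^+ m * m`!%:R.
Proof.
elim: m => [|m IHm]; first by rewrite /rising big_ord0 mulr1.
by rewrite risingSl -{2}natr1 opprD subrK IHm exprS factS natrM; ring.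
Qed.

(** Induction with [frac_sumS]. At the two extreme poles one of the two terms on
    its right is not at a pole, and has the closed form of [frac_sumE]. *)
Lemma frac_sum_pole (R : realType) n i : (i <= n)%N ->
  frac_sum R n (- i%:R) =
  alt_bin R n i * (harmonic_sum R i - harmonic_sum R (n - i)).
Proof.
elim: n i => [|n IHn] i.
  rewrite leqn0 => /eqP ->; rewrite /frac_sum big_ord1 oppr0 addr0 invr0.
  by rewrite subrr !mulr0.
rewrite frac_sumS; case: i => [_|i].
  have i0 := IHn 0%N isT; rewrite mulr0n oppr0 in i0.
  rewrite mulr0n oppr0 add0r i0 alt_bin0 !subn0.
  have r := rising_fact R n.+1 0; rewrite fact0 mulr1 add0n in r.
  rewrite (frac_sumE R n 1); last by move=> j _; rewrite nat1r pnatr_eq0.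
  rewrite r harmonic_sumS alt_bin0 factS natrM invfM mulrCA mulfV ?mulr1; first by ring.
  by rewrite pnatr_eq0 -lt0n fact_gt0.
rewrite ltnS => iin; rewrite -natr1 opprD subrK subSS.
have n0 k : k.+1%:R != 0 :> R by rewrite pnatr_eq0.
move: iin; rewrite leq_eqVlt => /predU1P[->|iin].
  rewrite -opprD natr1 (IHn n (leqnn n)) frac_sumE => [|j jn]; last first.
    by rewrite addrC subr_eq0 eqr_nat neq_ltn ltnS jn.
  rewrite rising_opp subnn harmonic_sumS alt_binS (alt_bin_small R n n.+1) // factS natrM.
  have sq : (-1) ^+ n * (-1) ^+ n = 1 :> R by rewrite -expr2 -exprM mulnC exprM sqrrN expr1n expr1n.
  rewrite /alt_bin binn exprS.
  have f0 : n`!%:R != 0 :> R by rewrite pnatr_eq0 -lt0n fact_gt0.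
  have s0 : (-1) ^+ n != 0 :> R by rewrite expf_neq0 // oppr_eq0 oner_eq0.
  rewrite (_ : _ / _ = - ((-1) ^+ n * ((-1) ^+ n * (-1) ^+ n)^-1) / n.+1%:R).
    by rewrite sq invr1; ring.
  have := n0 n; move: n.+1%:R => m m0.
  by field; rewrite f0 s0 m0.
rewrite -opprD natr1 (IHn _ iin) (IHn _ (ltnW iin)) alt_binS.
have [k kE] : exists k, (n - i)%N = k.+1 by exists (n - i).-1; lia.
have -> : (n - i.+1)%N = k by lia.
rewrite kE !harmonic_sumS.
(* The two changes of the harmonic sums cancel, as consecutive binomial
   coefficients are in the ratio [k.+1 / i.+1]. *)
have ab : alt_bin R n i.+1 / k.+1%:R = - (alt_bin R n i / i.+1%:R).
  apply: (canLR (mulfK (n0 k))); rewrite /alt_bin exprS.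
  have /(congr1 (fun x => x%:R : R)) := mul_bin_left n i.
  rewrite kE !natrM => h.
  have -> : 'C(n, i.+1)%:R = k.+1%:R * 'C(n, i)%:R / i.+1%:R :> R.
    by rewrite -h mulrAC mulfV // mul1r.
  by ring.
rewrite !mulrBl !mulrBr !mulrDr ab; ring.
Qed.

(** * Partial fractions of the square *)

(** The residue of the square of [frac_sum R n] at [- i]. *)
Definition residue (R : realType) (n i : nat) : R :=
  2 * alt_bin R n i * frac_sum R n (- i%:R).

Lemma alt_bin_sq (R : realType) n i : alt_bin R n i ^+ 2 = 'C(n, i)%:R ^+ 2.
Proof. by rewrite /alt_bin exprMn -exprM mulnC exprM sqrrN expr1n expr1n mul1r. Qed.

Lemma residueE (R : realType) n i : (i <= n)%N ->
  residue R n i = 2 * 'C(n, i)%:R ^+ 2 * (harmonic_sum R i - harmonic_sum R (n - i)).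
Proof. by move=> iin; rewrite /residue frac_sum_pole // -alt_bin_sq; ring. Qed.

Lemma residue_sub (R : realType) n i : (i <= n)%N -> residue R n (n - i) = - residue R n i.
Proof. by move=> iin; rewrite !residueE ?leq_subr // subKn // bin_sub //; ring. Qed.

(** Expand the square of [frac_sum] and split each product of two distinct
    simple poles; at equal indices the convention [0^-1 = 0] kills both terms. *)
Lemma frac_sum_sq (R : realType) n (t : R) : 0 < t ->
  frac_sum R n t ^+ 2 =
  \sum_(i < n.+1) ('C(n, i)%:R ^+ 2 / (t + i%:R) ^+ 2 + residue R n i / (t + i%:R)).
Proof.
move=> t0; pose a i := alt_bin R n i.
have ti (i : nat) : t + i%:R != 0 by rewrite gt_eqF // ltr_wpDr.
pose c (i j : nat) : R := (j%:R - i%:R)^-1.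
have prodE (i j : 'I_n.+1) : a i / (t + i%:R) * (a j / (t + j%:R)) =
    (if i == j then a i ^+ 2 / (t + i%:R) ^+ 2 else 0)
    + (a i / (t + i%:R) * (a j * c i j) + a j / (t + j%:R) * (a i * c j i)).
  rewrite /c; case: eqVneq => [->|ij].
    by rewrite subrr invr0 !mulr0 !addr0 expr2 expr2; field.
  have d1 : j%:R - i%:R != 0 :> R by rewrite subr_eq0 eqr_nat eq_sym.
  have d2 : i%:R - j%:R != 0 :> R by rewrite subr_eq0 eqr_nat.
  by field; rewrite !ti d1 d2.
have poleE (i : nat) : \sum_(j < n.+1) a j * c i j = frac_sum R n (- i%:R).
  by apply: eq_bigr => j _; rewrite /c [- _ + _]addrC.
have cross : \sum_(i < n.+1) \sum_(j < n.+1) a i / (t + i%:R) * (a j * c i j) =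
    \sum_(i < n.+1) a i * frac_sum R n (- i%:R) / (t + i%:R).
  by apply: eq_bigr => i _; rewrite -mulr_sumr poleE mulrAC.
have diag (i : 'I_n.+1) : \sum_(j < n.+1)
    (if i == j then a i ^+ 2 / (t + i%:R) ^+ 2 else 0) = a i ^+ 2 / (t + i%:R) ^+ 2.
  rewrite (bigD1 i) //= eqxx big1 ?addr0 // => j.
  by rewrite eq_sym => /negbTE ->.
rewrite expr2 {1}/frac_sum mulr_suml (eq_bigr (fun i : 'I_n.+1 =>
  a i ^+ 2 / (t + i%:R) ^+ 2
  + (\sum_(j < n.+1) a i / (t + i%:R) * (a j * c i j)
     + \sum_(j < n.+1) a j / (t + j%:R) * (a i * c j i)))) => [|i _]; last first.
  by rewrite -{1}diag -!big_split /= mulr_sumr; apply: eq_bigr => j _; rewrite prodE.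
rewrite !big_split /= [X in _ + (_ + X)]exchange_big /= cross.
rewrite -!big_split; apply: eq_bigr => i _ /=.
by rewrite /a alt_bin_sq /residue; ring.
Qed.

Lemma sum_residue (R : realType) n : \sum_(i < n.+1) residue R n i = 0.
Proof.
apply/eqP; rewrite -[_ == 0](mulrn_eq0 _ 2) mulr2n.
rewrite {1}(reindex_inj rev_ord_inj) /= -big_split big1 // => i _.
by rewrite /= subSS residue_sub ?addNr ?leq_ord.
Qed.

Lemma sum_bin_sq n : (\sum_(i < n.+1) 'C(n, i) ^ 2 = 'C(2 * n, n))%N.
Proof.
rewrite mul2n -addnn -binomial.Vandermonde; apply: eq_bigr => i _.
by rewrite bin_sub ?leq_ord.
Qed.

Lemma sum_alt_bin (R : realType) n : (0 < n)%N -> \sum_(i < n.+1) alt_bin R n i = 0.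
Proof.
move=> n0; have := exprBn (1 : R) 1 n; rewrite subrr expr0n gtn_eqF // mulr0n => h; rewrite [RHS]h.
by apply: eq_bigr => i _; rewrite !expr1n !mulr1 /alt_bin mulr_natr.
Qed.

(** Symmetrizing the double sum over [i] and [j] cancels the denominators [j - i];
    what is left is the sum over [i <> j] of [- alt_bin i * alt_bin j], where the
    full double sum vanishes. *)
Lemma sum_mul_residue (R : realType) n : (0 < n)%N ->
  \sum_(i < n.+1) i%:R * residue R n i = 'C(2 * n, n)%:R.
Proof.
move=> n0; pose a i := alt_bin R n i.
pose S := \sum_(i < n.+1) \sum_(j < n.+1) i%:R * (a i * a j) / (j%:R - i%:R).
have SE : \sum_(i < n.+1) i%:R * residue R n i = S + S.
  rewrite -big_split; apply: eq_bigr => i _; rewrite /residue /frac_sum -/(a i).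
  rewrite mulr_sumr mulr_sumr -big_split; apply: eq_bigr => j _.
  by rewrite -/(a j) [- _ + _]addrC /=; ring.
rewrite SE {2}/S exchange_big -big_split /=.
transitivity (\sum_(i < n.+1) (a i ^+ 2 - \sum_(j < n.+1) a i * a j)).
  apply: eq_bigr => i _; rewrite -big_split /= (bigD1 i) //= [in RHS](bigD1 i) //=.
  rewrite subrr invr0 !mulr0 addr0 add0r expr2 opprD addrA subrr add0r -sumrN.
  apply: eq_bigr => j ji.
  have d1 : j%:R - i%:R != 0 :> R by rewrite subr_eq0 eqr_nat.
  have d2 : i%:R - j%:R != 0 :> R by rewrite subr_eq0 eqr_nat eq_sym.
  by field; rewrite d1 d2.
rewrite sumrB [X in _ - X]big1 => [|i _]; last by rewrite -mulr_sumr sum_alt_bin ?mulr0.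
rewrite subr0 -sum_bin_sq natr_sum; apply: eq_bigr => i _.
by rewrite alt_bin_sq natrX.
Qed.

(** * The tail integrals and their majorant *)

(** The integral of [frac_sum R n ^+ 2] from [x] to infinity. It enters only
    through its derivative and its limit [0] at infinity. *)
Definition tail_term (R : realType) (n : nat) (x : R) : R :=
  \sum_(i < n.+1) ('C(n, i)%:R ^+ 2 / (x + i%:R) - residue R n i * ln (x + i%:R)).

Lemma is_derive_tail_term (R : realType) n (x : R) : 0 < x ->
  is_derive x 1 (tail_term R n) (- frac_sum R n x ^+ 2).
Proof.
move=> x0; have xi (i : nat) : 0 < x + i%:R by rewrite ltr_wpDr.
have d (i : nat) : is_derive x 1 (fun y : R => y + i%:R) 1.
  by apply: is_derive_eq; rewrite addr0.
have term (i : 'I_n.+1) : is_derive x 1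
    (fun y : R => 'C(n, i)%:R ^+ 2 / (y + i%:R) - residue R n i * ln (y + i%:R))
    (- ('C(n, i)%:R ^+ 2 / (x + i%:R) ^+ 2 + residue R n i / (x + i%:R))).
  have d1 := is_derive1_ln (xi i).
  have d2 := @is_derive1_comp _ (@ln R) (fun y => y + i%:R) x _ _ d1 (d i).
  have d3 := @is_deriveV R (fun y => y + i%:R) x 1 1 (lt0r_neq0 (xi i)) (d i).
  apply: is_derive_eq; rewrite /GRing.scale /=.
  by field; rewrite gt_eqF.
have -> : tail_term R n = \sum_(i < n.+1)
    (fun y : R => 'C(n, i)%:R ^+ 2 / (y + i%:R) - residue R n i * ln (y + i%:R)).
  by apply/funext => y; rewrite fct_sumE.
by apply: is_derive_eq; rewrite frac_sum_sq // sumrN.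
Qed.

Lemma rising_gt0 (R : realType) m (x : R) : 0 < x -> 0 < rising R m x.
Proof. by move=> x0; apply: prodr_gt0 => i _; rewrite ltr_wpDr. Qed.

Lemma ler_rising (R : realType) m (x y : R) : 0 < x <= y -> rising R m x <= rising R m y.
Proof.
move=> /andP[x0 xy]; apply: ler_prod => i _.
by rewrite lerD2r xy andbT addr_ge0 // ltW.
Qed.

Lemma frac_sum_pos (R : realType) n (x : R) : 0 < x ->
  frac_sum R n x = n`!%:R / rising R n.+1 x.
Proof. by move=> x0; rewrite frac_sumE // => j _; rewrite gt_eqF // ltr_wpDr. Qed.

Lemma tail_term_step (R : realType) n (x : R) : 0 < x ->
  0 < tail_term R n x - tail_term R n (x + 1) <= frac_sum R n x ^+ 2.
Proof.
move=> x0; have xx1 : x < x + 1 by rewrite ltrDl.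
have [y yx|c /andP[xc _] e] := mvt_is_derive R (tail_term R n)
    (fun y => - frac_sum R n y ^+ 2) _ _ xx1.
  by apply: is_derive_tail_term; lra.
have c0 : 0 < c by lra.
rewrite -opprB e addrAC subrr add0r mulr1 opprK !frac_sum_pos //.
have f0 : 0 < n`!%:R :> R by rewrite ltr0n fact_gt0.
have pos y : 0 < y -> 0 < n`!%:R / rising R n.+1 y by move=> y0; rewrite divr_gt0 ?rising_gt0.
rewrite exprn_gt0 ?pos //=; apply: lerXn2r; rewrite ?nnegrE ?(ltW (pos _ _)) //.
by rewrite ler_pM2l // lef_pV2 ?posrE ?rising_gt0 // ler_rising // x0 ltW.
Qed.

(** The constant makes the second difference of [majorant] an upper bound of
    [frac_sum R n ^+ 2] from [n + 1] on; second differences of reciprocals of rising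
    products are again such reciprocals. *)
Definition majorant (R : realType) (n : nat) (x : R) : R :=
  4 * n`!%:R ^+ 3 / (2 * n).+1`!%:R / rising R n.+1 x.

Lemma rising_inv_diff (R : realType) m (x : R) : 0 < x ->
  (rising R m x)^-1 - (rising R m (x + 1))^-1 = m%:R / rising R m.+1 x.
Proof.
move=> x0; have r0 := rising_gt0 R m (x + 1) (addr_gt0 x0 ltr01).
have xm : 0 < x + m%:R by rewrite ltr_wpDr.
have rE : rising R m x = x * rising R m (x + 1) / (x + m%:R).
  by rewrite -risingSl risingS mulfK // gt_eqF.
by rewrite risingSl rE; field; rewrite !gt_eqF.
Qed.

Lemma majorant_diff (R : realType) n (x : R) : 0 < x ->
  majorant R n x - majorant R n (x + 1) =
  4 * n`!%:R ^+ 3 / (2 * n).+1`!%:R * (n.+1%:R / rising R n.+2 x).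
Proof. by move=> x0; rewrite /majorant -mulrBr rising_inv_diff. Qed.

(** After cancelling [rising R n.+1 x], the claim bounds
    [(x + n + 1) * (x + n + 2) / rising R n.+1 x], where two factors of the
    denominator absorb the numerator up to [4] and the others are least at
    [x = n + 1]. *)
Lemma frac_sum_sq_le (R : realType) n (x : R) : (0 < n)%N -> n.+1%:R <= x ->
  frac_sum R n x ^+ 2 <=
  (majorant R n x - majorant R n (x + 1)) -
  (majorant R n (x + 1) - majorant R n (x + 1 + 1)).
Proof.
move=> n0 nx; have x0 : 0 < x by apply: lt_le_trans nx; rewrite ltr0n.
have x10 : 0 < x + 1 by lra.
have -> : majorant R n x - majorant R n (x + 1) -
    (majorant R n (x + 1) - majorant R n (x + 1 + 1)) =
    4 * n`!%:R ^+ 3 / (2 * n).+1`!%:R * (n.+1%:R * (n.+2%:R / rising R n.+3 x)).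
  by rewrite !majorant_diff // -mulrBr -mulrBr rising_inv_diff.
have f0 k : 0 < k`!%:R :> R by rewrite ltr0n fact_gt0.
have r0 := rising_gt0 R n.+1 x x0.
have n1 : 0 < x + n.+1%:R by rewrite addr_gt0 ?ltr0n.
have n2 : 0 < x + n.+2%:R by rewrite addr_gt0 ?ltr0n.
have key : n`!%:R ^+ 2 * ((x + n.+1%:R) * (x + n.+2%:R)) <=
    4 * n`!%:R ^+ 3 / (2 * n).+1`!%:R * (n.+1%:R * n.+2%:R) * rising R n.+1 x.
  case: n n0 nx f0 {r0} n1 n2 => // m _ mx f0 n1 n2.
  have e := rising_fact R m m.+3.
  have mono : rising R m m.+4%:R <= rising R m (x + 1 + 1).
    apply: ler_rising; rewrite ltr0n /= -[m.+4]addn1 natrD lerD2r.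
    by rewrite -[m.+3]addn1 natrD lerD2r.
  have quad : (x + m.+2%:R) * (x + m.+3%:R) <= 4 * (x * (x + 1)).
    rewrite -[m.+3]addn1 natrD; nra.
  rewrite !risingSl; apply: (@le_trans _ _ (m.+1`!%:R ^+ 2 * (4 * (x * (x + 1))))).
    by rewrite ler_pM2l // exprn_gt0.
  have -> : (2 * m.+1).+1`!%:R = rising R m m.+4%:R * (m.+3%:R * (m.+2%:R * m.+1`!%:R)).
    by rewrite -natrM -factS -natrM -factS e; congr (_`!%:R); lia.
  set g := m.+1`!%:R in f0 *; have g0 : 0 < g by apply: f0.
  have rm0 := rising_gt0 R m m.+4%:R (ltr0Sn _ _).
  have m2 : 0 < m.+2%:R :> R by rewrite ltr0n.
  have m3 : 0 < m.+3%:R :> R by rewrite ltr0n.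
  have -> : 4 * g ^+ 3 / (rising R m m.+4%:R * (m.+3%:R * (m.+2%:R * g))) *
      (m.+2%:R * m.+3%:R) * (x * ((x + 1) * rising R m (x + 1 + 1))) =
      g ^+ 2 * (4 * (x * (x + 1))) * (rising R m (x + 1 + 1) / rising R m m.+4%:R).
    by field; rewrite !gt_eqF.
  rewrite ler_peMr ?ler_pdivlMr ?mul1r //.
  by rewrite mulr_ge0 ?exprn_ge0 ?mulr_ge0 // ltW.
rewrite frac_sum_pos //; move: key r0.
set r := rising R n.+1 x; set c := _ / _; set u := x + _; set v := x + _ => key r0.
have -> : rising R n.+3 x = r * u * v by rewrite risingS risingS.
have -> : (n`!%:R / r) ^+ 2 = (n`!%:R ^+ 2 * (u * v)) / (r ^+ 2 * (u * v)).
  by field; rewrite !gt_eqF.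
have -> : c * (n.+1%:R * (n.+2%:R / (r * u * v))) =
    (c * (n.+1%:R * n.+2%:R) * r) / (r ^+ 2 * (u * v)).
  by field; rewrite !gt_eqF.
by rewrite ler_pM2r // invr_gt0 !mulr_gt0 // exprn_gt0.
Qed.

Lemma majorant_start (R : realType) n :
  majorant R n n.+1%:R = 4 / ((2 * n).+1%:R * 'C(2 * n, n)%:R) ^+ 2.
Proof.
rewrite /majorant; have f0 k : k`!%:R != 0 :> R by rewrite pnatr_eq0 -lt0n fact_gt0.
have c0 : 'C(2 * n, n)%:R != 0 :> R by rewrite pnatr_eq0 -lt0n bin_gt0 leq_pmull.
have -> : rising R n.+1 n.+1%:R = (2 * n).+1`!%:R / n`!%:R.
  apply: (canRL (mulfK (f0 n))); rewrite rising_fact; congr (_`!%:R); lia.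
have n0 : (2 * n).+1%:R != 0 :> R by rewrite pnatr_eq0.
have -> : (2 * n).+1`!%:R = (2 * n).+1%:R * ('C(2 * n, n)%:R * n`!%:R ^+ 2) :> R.
  rewrite factS natrM -(@bin_fact (2 * n) n) ?leq_pmull // !natrM.
  by rewrite (_ : (2 * n - n = n)%N) // mul2n -addnn addnK.
move: (f0 n) n0 c0; move: n`!%:R (2 * n).+1%:R 'C(2 * n, n)%:R => g a b g0 a0 b0.
by field; rewrite g0 a0 b0.
Qed.

(** * Limits *)

Lemma cvg_inv_shift (R : realType) (m : nat) :
  (fun N : nat => (N%:R + m%:R : R)^-1) @ \oo --> 0.
Proof.
rewrite -cvg_shiftS /=.
apply: (@squeeze_cvgr _ _ _ _ (fun=> 0) (@harmonic R)).
- near=> N; rewrite invr_ge0 addr_ge0 //= lef_pV2 ?posrE ?ltr_wpDr ?ltr0n //.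
  by rewrite lerDl.
- exact: cvg_cst.
- exact: cvg_harmonic.
Unshelve. all: by end_near. Qed.

Lemma cvg_ln_shift (R : realType) (m : nat) :
  (fun N : nat => ln (N%:R + m%:R : R) - ln N%:R) @ \oo --> 0.
Proof.
rewrite -cvg_shiftS /=.
apply: (@squeeze_cvgr _ _ _ _ (fun=> 0) (fun N : nat => m%:R * @harmonic R N)).
- near=> N; have N0 : 0 < N.+1%:R :> R by rewrite ltr0n.
  have Nm : 0 < N.+1%:R + m%:R :> R by rewrite ltr_wpDr.
  rewrite subr_ge0 ler_ln ?posrE // lerDl ler0n /= -ln_div ?posrE //.
  rewrite mulrDl mulfV ?gt_eqF // le_ln1Dx //.
  by rewrite (@lt_le_trans _ _ 0) ?ltrN10 // divr_ge0 // ltW.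
- exact: cvg_cst.
- by rewrite -[0](mulr0 m%:R); apply: cvgM; [exact: cvg_cst|exact: cvg_harmonic].
Unshelve. all: by end_near. Qed.

Lemma cvg_sum_ord (R : realType) m (F : 'I_m -> nat -> R) (l : 'I_m -> R) :
  (forall i, F i @ \oo --> l i) ->
  (fun N => \sum_(i < m) F i N) @ \oo --> \sum_(i < m) l i.
Proof.
move=> h; rewrite (_ : (fun N => _) = \sum_(i < m) F i); last first.
  by apply/funext => N; rewrite fct_sumE.
by elim/big_ind2: _ => //; [exact: cvg_cst|move=> *; exact: cvgD].
Qed.

(** As the residues sum to [0], each [ln (N + i)] may be replaced by
    [ln (N + i) - ln N]. *)
Lemma tail_term_cvg0 (R : realType) n :
  (fun N : nat => tail_term R n N%:R) @ \oo --> 0.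
Proof.
have -> : (fun N : nat => tail_term R n N%:R) = (fun N : nat => \sum_(i < n.+1)
   ('C(n, i)%:R ^+ 2 * (N%:R + i%:R)^-1
    - residue R n i * (ln (N%:R + i%:R) - ln N%:R))).
  apply/funext => N; rewrite /tail_term.
  rewrite [RHS](eq_bigr (fun i : 'I_n.+1 => ('C(n, i)%:R ^+ 2 / (N%:R + i%:R)
    - residue R n i * ln (N%:R + i%:R)) + residue R n i * ln N%:R)).
    by rewrite [RHS]big_split /= -mulr_suml sum_residue mul0r addr0.
  by move=> i _; ring.
have h0 : \sum_(i < n.+1) ('C(n, i)%:R ^+ 2 * 0 - residue R n i * 0) = 0 :> R.
  by rewrite big1 // => i _; rewrite !mulr0 subrr.
rewrite -[X in _ --> X]h0.
apply: (cvg_sum_ord R n.+1 (fun i N => 'C(n, i)%:R ^+ 2 * (N%:R + i%:R)^-1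
    - residue R n i * (ln (N%:R + i%:R) - ln N%:R))
  (fun i => 'C(n, i)%:R ^+ 2 * 0 - residue R n i * 0)) => i.
apply: cvgB; apply: cvgM; try exact: cvg_cst.
  exact: cvg_inv_shift.
exact: cvg_ln_shift.
Qed.

Lemma majorant_cvg0 (R : realType) n :
  (fun N : nat => majorant R n N%:R) @ \oo --> 0.
Proof.
rewrite -cvg_shiftS /=; set c : R := 4 * n`!%:R ^+ 3 / (2 * n).+1`!%:R.
have c0 : 0 <= c by rewrite divr_ge0 ?mulr_ge0 ?exprn_ge0.
apply: (@squeeze_cvgr _ _ _ _ (fun=> 0) (fun N : nat => c * @harmonic R N)).
- near=> N; have N0 : 0 < N.+1%:R :> R by rewrite ltr0n.
  have r0 := rising_gt0 R n.+1 _ N0.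
  rewrite /majorant -/c mulr_ge0 ?invr_ge0 ?(ltW r0) //= ler_wpM2l //.
  rewrite lef_pV2 ?posrE // risingSl ler_peMr // /rising.
  elim/big_ind: _ => // [x y x1 y1|i _]; first by rewrite mulr_ege1.
  by have := ler0n R N.+1; have := ler0n R i; lra.
- exact: cvg_cst.
- by rewrite -[0](mulr0 c); apply: cvgM; [exact: cvg_cst|exact: cvg_harmonic].
Unshelve. all: by end_near. Qed.

Lemma nonincreasing_cvg0_ge0 (R : realType) (u : nat -> R) :
  (forall k, u k.+1 <= u k) -> u @ \oo --> 0 -> forall k, 0 <= u k.
Proof.
move=> /nonincreasing_seqP du u0 k.
have <- : limn u = 0 by apply: cvg_lim.
by apply: nonincreasing_cvgn_ge => //; apply/cvg_ex; exists 0.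
Qed.

(** * Summation of the tail integrals *)

(** [tail_term] decreases to its limit [0]. *)
Lemma tail_term_gt0 (R : realType) n k : (0 < k)%N -> 0 < tail_term R n k%:R.
Proof.
case: k => // k _; pose u j : R := tail_term R n j.+1%:R.
have du j : u j.+1 < u j.
  have := tail_term_step R n j.+1%:R; rewrite ltr0n natr1 => /(_ isT) /andP[].
  by rewrite subr_gt0.
apply: le_lt_trans (du k); apply: (nonincreasing_cvg0_ge0 R u) => [j|].
  exact: ltW.
by have := tail_term_cvg0 R n; rewrite -cvg_shiftS.
Qed.

(** Both sides tend to [0], and by [frac_sum_sq_le] the right-hand side decreases
    at least as fast as the left-hand side. *)
Lemma tail_term_le (R : realType) n k : (0 < n)%N -> (n < k)%N ->
  tail_term R n k%:R <= majorant R n k%:R - majorant R n k.+1%:R.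
Proof.
move=> n0 nk; pose m (j : nat) : R := majorant R n j%:R.
pose u j : R := m (j + n.+1)%N - m (j + n.+1).+1 - tail_term R n (j + n.+1)%:R.
have du j : u j.+1 <= u j.
  have x0 : 0 < (j + n.+1)%:R :> R by rewrite ltr0n addnS.
  have nx : n.+1%:R <= (j + n.+1)%:R :> R by rewrite ler_nat leq_addl.
  have /andP[_] := tail_term_step R n _ x0.
  have := frac_sum_sq_le R n _ n0 nx.
  by rewrite !natr1 /u addSn -!/(m _); lra.
have u0 : u @ \oo --> 0.
  rewrite -[X in _ --> X](subr0 (0 : R)) -[X in _ --> X - _](subr0 (0 : R)).
  apply: cvgB; [apply: cvgB|].
  - by have := majorant_cvg0 R n; rewrite -(cvg_shiftn n.+1).
  - have := majorant_cvg0 R n; rewrite -(cvg_shiftn n.+2).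
    by under eq_fun do rewrite addnS.
  - by have := tail_term_cvg0 R n; rewrite -(cvg_shiftn n.+1).
have := nonincreasing_cvg0_ge0 R u du u0 (k - n.+1)%N.
by rewrite /u subnK // subr_ge0.
Qed.

Lemma sum_tail_term_bounds (R : realType) n N : (0 < n)%N ->
  tail_term R n n.+1%:R <= \sum_(k < N.+1) tail_term R n (n.+1 + k)%:R
  <= majorant R n n.+1%:R.
Proof.
move=> n0; apply/andP; split.
  rewrite big_ord_recl addn0 lerDl sumr_ge0 // => k _.
  by rewrite ltW // tail_term_gt0.
have h M : \sum_(k < M) tail_term R n (n.+1 + k)%:R <=
    majorant R n n.+1%:R - majorant R n (n.+1 + M)%:R.
  elim: M => [|M IHM]; first by rewrite big_ord0 addn0 subrr.
  rewrite big_ord_recr /=; have := tail_term_le R n (n.+1 + M) n0 (leq_addr _ _).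
  by rewrite addnS; lra.
apply: le_trans (h _) _; rewrite lerBlDr lerDl /majorant.
by rewrite !mulr_ge0 ?exprn_ge0 ?invr_ge0 // ltW // rising_gt0 // ltr0n addnS.
Qed.

(** A primitive, in the discrete sense, of [tail_term] on the natural numbers. *)
Definition tail_primitive (R : realType) (n M : nat) : R :=
  \sum_(i < n.+1) ('C(n, i)%:R ^+ 2 * harmonic_sum R (M + i)
                   - residue R n i * ln (M + i)`!%:R).

Lemma tail_primitiveS (R : realType) n M :
  tail_primitive R n M.+1 = tail_primitive R n M + tail_term R n M.+1%:R.
Proof.
rewrite /tail_primitive /tail_term -big_split; apply: eq_bigr => i _ /=.
rewrite addSn harmonic_sumS factS natrM lnM ?posrE ?ltr0n ?fact_gt0 //.
by rewrite -natrD addSn; ring.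
Qed.

Lemma sum_tail_term (R : realType) n N :
  \sum_(k < N) tail_term R n (n.+1 + k)%:R =
  tail_primitive R n (n + N) - tail_primitive R n n.
Proof.
elim: N => [|N IHN]; first by rewrite big_ord0 addn0 subrr.
by rewrite big_ord_recr /= IHN addnS tail_primitiveS addSn addrAC.
Qed.

Lemma ln_step_bounds (R : realType) N : (0 < N)%N ->
  (N.+1%:R^-1 : R) <= ln (N.+1%:R : R) - ln N%:R <= N%:R^-1.
Proof.
move=> N0; have n0 : 0 < N%:R :> R by rewrite ltr0n.
have s0 : 0 < N.+1%:R :> R by rewrite ltr0n.
have h1 : ln (N.+1%:R / N%:R) <= N%:R^-1 :> R.
  have -> : N.+1%:R / N%:R = 1 + N%:R^-1 :> R by rewrite -nat1r mulrDl mul1r mulfV ?gt_eqF // addrC.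
  by rewrite le_ln1Dx // (lt_trans (ltrN10 _)) // invr_gt0.
have h2 : ln (N%:R / N.+1%:R) <= - N.+1%:R^-1 :> R.
  have -> : N%:R / N.+1%:R = 1 + - N.+1%:R^-1 :> R.
    by rewrite -[N%:R](addrK 1) natr1 mulrBl mul1r mulfV ?gt_eqF.
  by rewrite le_ln1Dx // ltrN2 invf_lt1 // ltr1n ltnS.
move: h1 h2; rewrite !ln_div ?posrE // => h1 h2;
by rewrite h1 andbT -lerN2 opprB.
Qed.

(** The sequence decreases from [N = 1] on and is nonnegative. *)
Lemma euler_gamma_cvg (R : realType) :
  (fun N : nat => harmonic_sum R N - ln N%:R) @ \oo --> euler_gamma R.
Proof.
suff : cvgn (fun N : nat => harmonic_sum R N - ln N%:R) by [].
apply/cvg_ex; pose u N : R := harmonic_sum R N.+1 - ln N.+1%:R.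
have du N : u N.+1 <= u N.
  have /andP[h _] := ln_step_bounds R _ (ltn0Sn N); rewrite /u harmonic_sumS.
  by move: h; move: (N.+2%:R^-1) => r; lra.
have u0 N : 0 <= u N.
  suff : ln N.+2%:R <= harmonic_sum R N.+1.
    rewrite /u; have /andP[h _] := ln_step_bounds R _ (ltn0Sn N).
    have : 0 <= N.+2%:R^-1 :> R by rewrite invr_ge0.
    by move: h; move: (N.+2%:R^-1) => r; lra.
  elim: N => [|N IHN].
    have /andP[_] := ln_step_bounds R _ (ltn0Sn 0).
    by rewrite ln1 subr0 /harmonic_sum big_nat1.
  have /andP[_ h] := ln_step_bounds R _ (ltn0Sn N.+1); rewrite harmonic_sumS.
  by move: h; move: (N.+2%:R^-1) => r; lra.
have /cvg_ex[l ul] : cvgn u.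
  apply: nonincreasing_is_cvgn; first exact/nonincreasing_seqP.
  by exists 0 => _ [N _ <-]; apply: u0.
by exists l; rewrite -cvg_shiftS.
Qed.

(** * The logarithm of Sondow's product *)

Lemma ln_fact_add (R : realType) M i :
  ln ((M + i)`!%:R : R) = ln M`!%:R + \sum_(l < i) ln (M%:R + l.+1%:R).
Proof.
elim: i => [|i IHi]; first by rewrite addn0 big_ord0 addr0.
rewrite addnS factS natrM lnM ?posrE ?ltr0n ?fact_gt0 // IHi big_ord_recr /=.
by rewrite -natrD addnS [LHS]addrC addrA.
Qed.

(** The two relations on the residues turn [harmonic_sum R (M + i)] into
    [harmonic_sum R (M + i) - ln M] and [ln (M + i)`!] into
    [ln (M + i)`! - ln M`! - i * ln M], both of which converge. *)
Lemma tail_primitive_cvg (R : realType) n : (0 < n)%N ->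
  tail_primitive R n @ \oo --> 'C(2 * n, n)%:R * euler_gamma R.
Proof.
move=> n0; pose e N : R := harmonic_sum R N - ln N%:R.
pose F (i : 'I_n.+1) (M : nat) : R :=
  'C(n, i)%:R ^+ 2 * (e (M + i)%N + (ln (M%:R + i%:R) - ln M%:R))
  - residue R n i * \sum_(l < i) (ln (M%:R + l.+1%:R) - ln M%:R).
have -> : tail_primitive R n = fun M => \sum_(i < n.+1) F i M.
  apply/funext => M; rewrite /tail_primitive.
  transitivity (\sum_(i < n.+1) (F i M + (ln M%:R * 'C(n, i)%:R ^+ 2
     - ln M`!%:R * residue R n i - ln M%:R * (i%:R * residue R n i)))).
    apply: eq_bigr => i _; rewrite /F /e ln_fact_add sumrB sumr_const card_ord.
    by rewrite -mulr_natl natrD; ring.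
  rewrite big_split /= !sumrB -!mulr_sumr sum_residue sum_mul_residue // -sum_bin_sq.
  rewrite natr_sum; under [X in _ - _ * X]eq_bigr do rewrite natrX.
  by rewrite mulr0 subr0 subrr addr0.
have limE : 'C(2 * n, n)%:R * euler_gamma R =
    \sum_(i < n.+1) ('C(n, i)%:R ^+ 2 * (euler_gamma R + 0) - residue R n i * 0).
  rewrite -sum_bin_sq natr_sum mulr_suml; apply: eq_bigr => i _.
  by rewrite natrX addr0 mulr0 subr0.
rewrite limE; apply: (cvg_sum_ord R n.+1 F (fun i =>
  'C(n, i)%:R ^+ 2 * (euler_gamma R + 0) - residue R n i * 0)) => i.
rewrite /F.
apply: cvgB; apply: cvgM; try exact: cvg_cst.
  apply: cvgD; last exact: cvg_ln_shift.
  by have := euler_gamma_cvg R; rewrite -(cvg_shiftn i).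
rewrite -[X in _ --> X](_ : \sum_(l < i) 0 = 0); last by rewrite big1.
apply: (cvg_sum_ord R i (fun l M => ln (M%:R + l.+1%:R) - ln M%:R) (fun=> 0)) => l.
exact: cvg_ln_shift.
Qed.

Lemma ln_prod_gt0 (R : realType) (I : eqType) (s : seq I) (F : I -> R) :
  (forall i, i \in s -> 0 < F i) ->
  0 < \prod_(i <- s) F i /\ ln (\prod_(i <- s) F i) = \sum_(i <- s) ln (F i).
Proof.
elim: s => [|i s IHs] h; first by rewrite !big_nil ln1.
have [|p0 pE] := IHs; first by move=> j js; apply: h; rewrite inE js orbT.
have i0 := h i (mem_head _ _).
by rewrite !big_cons mulr_gt0 // lnM ?posrE // pE.
Qed.

(** By the antisymmetry of the residues their partial sums from [k] on agree
    both with those of [- residue] below [k] and with those up to [n - k]; of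
    the two, the shorter one keeps [i <= n - i]. *)
Lemma sum_residue_from (R : realType) n k : (0 < k <= n)%N ->
  \sum_(k <= i < n.+1) residue R n i =
  \sum_(0 <= i < (minn (k - 1) (n - k)).+1)
    - residue R n i.
Proof.
move=> /andP[k0 kn]; rewrite /minn; case: ifP => _.
  rewrite subn1 prednK // sumrN; apply/eqP; rewrite -subr_eq0 opprK addrC.
  rewrite -big_cat_nat ?(leqW kn) //=.
  by rewrite big_mkord sum_residue.
rewrite [RHS]big_nat_rev /= add0n.
rewrite -{1}[k]add0n big_addn subSn // [RHS]big_nat [LHS]big_nat.
apply: eq_bigr => i /andP[_]; rewrite ltnS => ik.
have -> : ((n - k).+1 - i.+1 = n - (i + k))%N by lia.
by rewrite residue_sub ?opprK //; lia.
Qed.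

Lemma neg_residueE (R : realType) n i : (2 * i <= n)%N ->
  - residue R n i = \sum_(i.+1 <= j < (n - i).+1) 2 / j%:R * 'C(n, i)%:R ^+ 2.
Proof.
move=> iin; rewrite residueE; last by lia.
rewrite /harmonic_sum (@big_cat_nat _ _ _ i.+1 1 (n - i).+1) //=; last by lia.
rewrite -mulr_suml -mulr_sumr; ring.
Qed.

(** Write [ln (n + i)`!] as [ln n`!] plus the sum of [ln (n + k)] for [k <= i], and
    sum over [i] first: the coefficient of [ln (n + k)] is a partial sum of residues,
    evaluated by [sum_residue_from], and [ln n`!] cancels. *)
Lemma ln_sondow_S (R : realType) n :
  ln (sondow_S R n) =
  (lcm_upto (2 * n))%:R * \sum_(i < n.+1) residue R n i * ln (n + i)`!%:R.
Proof.
have pos k e : (0 < k)%N -> 0 < (n + k)%:R `^ e :> R.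
  by move=> k0; rewrite powR_gt0 // ltr0n addn_gt0 k0 orbT.
set d := (lcm_upto _)%:R.
have -> : \sum_(i < n.+1) residue R n i * ln (n + i)`!%:R =
    \sum_(1 <= k < n.+1) ln (n + k)%:R * \sum_(k <= i < n.+1) residue R n i.
  transitivity (\sum_(i < n.+1) \sum_(1 <= k < n.+1)
      (if (k <= i)%N then residue R n i * ln (n + k)%:R else 0)).
    transitivity (\sum_(i < n.+1) (residue R n i * ln n`!%:R +
       residue R n i * \sum_(l < i) ln (n%:R + l.+1%:R))).
      by apply: eq_bigr => i _; rewrite ln_fact_add mulrDr.
    rewrite big_split /= -mulr_suml sum_residue mul0r add0r.
    apply: eq_bigr => i _; rewrite (@big_cat_nat _ _ _ i.+1) //=.
    rewrite [X in _ = _ + X]big_nat_cond [X in _ = _ + X]big1 ?addr0; last first.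
      by move=> k; rewrite andbT => /andP[ik _]; rewrite leqNgt ik.
    rewrite big_add1 /= mulr_sumr big_mkord; apply: eq_bigr => l _.
    by rewrite ltn_ord -natrD.
  rewrite exchange_big /=; apply: eq_big_nat => k /andP[k0 kn].
  rewrite -(big_mkord xpredT (fun i => if (k <= i)%N then residue R n i * ln (n + k)%:R else 0)).
  rewrite (@big_cat_nat _ _ _ k) //=; last exact: ltnW.
  rewrite big_nat_cond big1 ?add0r => [|i]; last first.
    by rewrite andbT => /andP[_ ik]; rewrite leqNgt ik.
  rewrite mulr_sumr; apply: eq_big_nat => i /andP[-> _].
  by rewrite mulrC.
rewrite mulr_sumr /sondow_S.
have inner k i : (0 < k)%N ->
    0 < \prod_(i.+1 <= j < (n - i).+1)
      ((n + k)%:R `^ (2 * d / j%:R * 'C(n, i)%:R ^+ 2)) /\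
    ln (\prod_(i.+1 <= j < (n - i).+1)
      ((n + k)%:R `^ (2 * d / j%:R * 'C(n, i)%:R ^+ 2))) =
    \sum_(i.+1 <= j < (n - i).+1) ln (n + k)%:R * d * (2 / j%:R * 'C(n, i)%:R ^+ 2) :> R.
  move=> k0; have [|p0 ->] := ln_prod_gt0 R _ (index_iota i.+1 (n - i).+1)
      (fun j => (n + k)%:R `^ (2 * d / j%:R * 'C(n, i)%:R ^+ 2)).
    by move=> j _; apply: pos.
  by split=> //; apply: eq_bigr => j _; rewrite ln_powR; ring.
have middle k : (0 < k)%N ->
    0 < \prod_(0 <= i < (minn (k - 1) (n - k)).+1) \prod_(i.+1 <= j < (n - i).+1)
      ((n + k)%:R `^ (2 * d / j%:R * 'C(n, i)%:R ^+ 2)) /\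
    ln (\prod_(0 <= i < (minn (k - 1) (n - k)).+1) \prod_(i.+1 <= j < (n - i).+1)
      ((n + k)%:R `^ (2 * d / j%:R * 'C(n, i)%:R ^+ 2))) =
    \sum_(0 <= i < (minn (k - 1) (n - k)).+1) \sum_(i.+1 <= j < (n - i).+1)
      ln (n + k)%:R * d * (2 / j%:R * 'C(n, i)%:R ^+ 2) :> R.
  move=> k0; have [|p0 ->] := ln_prod_gt0 R _ (index_iota 0 (minn (k - 1) (n - k)).+1)
    (fun i => \prod_(i.+1 <= j < (n - i).+1)
      ((n + k)%:R `^ (2 * d / j%:R * 'C(n, i)%:R ^+ 2))).
    by move=> i _; have [] := inner k i k0.
  by split=> //; apply: eq_bigr => i _; have [] := inner k i k0.
have [|_ ->] := ln_prod_gt0 R _ (index_iota 1 n.+1)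
  (fun k => \prod_(0 <= i < (minn (k - 1) (n - k)).+1) \prod_(i.+1 <= j < (n - i).+1)
      ((n + k)%:R `^ (2 * d / j%:R * 'C(n, i)%:R ^+ 2))).
  by move=> k; rewrite mem_index_iota => /andP[k0 _]; have [] := middle k k0.
apply: eq_big_nat => k /andP[k0 kn].
have [_ ->] := middle k k0.
rewrite sum_residue_from ?k0 // mulrA [d * _]mulrC mulr_sumr.
apply: eq_big_nat => i /andP[_ ik].
by rewrite -mulr_sumr neg_residueE //; lia.
Qed.

(** * Size of the error term and conclusion *)

(** From [n] to [n + 1] the right-hand side grows by the factor
    [4 * (2 * n + 1) ^ 2 / (n * (n + 1))], which exceeds [16]. *)
Lemma central_bin_sq_ge n : (0 < n)%N -> (16 ^ n <= 4 * n * 'C(2 * n, n) ^ 2)%N.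
Proof.
case: n => // n _; elim: n => [//|n IHn].
have rec : (n.+2 * 'C(2 * n.+2, n.+2) = 2 * (2 * n.+1).+1 * 'C(2 * n.+1, n.+1))%N.
  have e1 := mul_bin_diag (2 * n.+2) n.+1.
  have e2 := mul_bin_down (2 * n.+2).-1 n.+1.
  have h1 : ((2 * n.+2).-1.-1 = 2 * n.+1)%N by lia.
  have h2 : ((2 * n.+2).-1 - n.+1 = n.+2)%N by lia.
  have h3 : ((2 * n.+2).-1 = (2 * n.+1).+1)%N by lia.
  rewrite h1 h2 h3 in e2; rewrite h3 in e1.
  rewrite -e1; apply/eqP; rewrite -(eqn_pmul2l (ltn0Sn n.+1)); apply/eqP.
  by rewrite mulnCA -e2; lia.
have a0 := ltn0Sn n.+1.
rewrite -(leq_pmul2l a0) expnS.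
have -> : (n.+2 * (4 * n.+2 * 'C(2 * n.+2, n.+2) ^ 2) =
           4 * (n.+2 * 'C(2 * n.+2, n.+2)) ^ 2)%N by lia.
rewrite rec; set c := 'C(2 * n.+1, n.+1) in IHn *.
apply: (@leq_trans (16 * n.+2 * (4 * n.+1 * c ^ 2))%N).
  by rewrite mulnA [(n.+2 * 16)%N]mulnC leq_mul2l IHn orbT.
nia.
Qed.

(** For [3 <= n] the two estimates leave the gap between [16 * n] and
    [(2 * n + 1) ^ 2]; for smaller [n] the numbers are computed. *)
Lemma lcm_upto_lt_central_bin (R : realType) n : (0 < n)%N ->
  (lcm_upto (2 * n))%:R * 4 * 2 ^+ n < ((2 * n).+1%:R * 'C(2 * n, n)%:R) ^+ 2 :> R.
Proof.
move=> n0; have [n3|] := leqP 3 n; last first.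
  move=> n3; have : (lcm_upto (2 * n) * 4 * 2 ^ n < ((2 * n).+1 * 'C(2 * n, n)) ^ 2)%N.
    by case: n n0 n3 => [//|[_ _|[_ _|//]]]; rewrite !lcm_uptoS /lcm_upto big_geq.
  by rewrite -(ltr_nat R) natrX !natrM natrX.
have h1 := lcm_upto_double_le R n.
have h2 : 16 ^+ n <= 4 * n%:R * 'C(2 * n, n)%:R ^+ 2 :> R.
  by rewrite -!natrX -!natrM ler_nat central_bin_sq_ge.
have p2 : 0 < 2 ^+ n :> R by rewrite exprn_gt0.
have c0 : 0 < 'C(2 * n, n)%:R ^+ 2 :> R.
  by rewrite exprn_gt0 // ltr0n bin_gt0 leq_pmull.
apply: (@le_lt_trans _ _ (8 ^+ n * 4 * 2 ^+ n)).
  by rewrite !ler_pM2r.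
have -> : 8 ^+ n * 4 * 2 ^+ n = 4 * 16 ^+ n :> R.
  by rewrite mulrAC -exprMn -natrM mulrC.
have n3R : 3 <= n%:R :> R by rewrite (ler_nat R 3).
apply: (@le_lt_trans _ _ (16 * n%:R * 'C(2 * n, n)%:R ^+ 2)); first by lra.
rewrite exprMn ltr_pM2r // -[(2 * n).+1%:R]nat1r natrM; nra.
Qed.

(** The error term of the approximation to [euler_gamma] is a convergent sum of
    positive terms below the telescoping [majorant]. *)
Lemma gamma_approx_bounds (R : realType) n : (0 < n)%N ->
  (0 : R) < 'C(2 * n, n)%:R * euler_gamma R - tail_primitive R n n <=
  4 / ((2 * n).+1%:R * 'C(2 * n, n)%:R) ^+ 2.
Proof.
move=> n0; pose S N := \sum_(k < N.+1) tail_term R n (n.+1 + k)%:R.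
have SE : S = fun N => tail_primitive R n (N + n.+1) - tail_primitive R n n.
  by apply/funext => N; rewrite /S sum_tail_term addnS addnS addnC.
have Scvg : S @ \oo --> 'C(2 * n, n)%:R * euler_gamma R - tail_primitive R n n.
  rewrite SE; apply: cvgB; last exact: cvg_cst.
  by have := tail_primitive_cvg R n n0; rewrite -(cvg_shiftn n.+1).
have lim : limn S = 'C(2 * n, n)%:R * euler_gamma R - tail_primitive R n n.
  exact: cvg_lim.
have cS : cvgn S by apply/cvg_ex; eexists; exact: Scvg.
rewrite -majorant_start -lim; apply/andP; split.
  apply: (lt_le_trans (tail_term_gt0 R n n.+1 isT)).
  apply: limr_ge => //; apply: nearW => N.
  by have /andP[] := sum_tail_term_bounds R n N n0.
apply: limr_le => //; apply: nearW => N.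
by have /andP[] := sum_tail_term_bounds R n N n0.
Qed.

Lemma lcm_upto_harmonic_int (R : realType) m k : (k <= m)%N ->
  (lcm_upto m)%:R * harmonic_sum R k \is a Num.int.
Proof.
move=> km; rewrite /harmonic_sum mulr_sumr big_nat_cond rpred_sum // => j.
rewrite andbT => /andP[j0 jk].
have /dvdnP[q ->] : (j %| lcm_upto m)%N by rewrite dvdn_lcm_upto // j0 (leq_trans _ km).
by rewrite natrM mulfK ?natr_int // pnatr_eq0 -lt0n.
Qed.

Lemma frac_part_small (R : realType) (x y : R) :
  x - y \is a Num.int -> 0 <= y < 1 -> frac_part x = y.
Proof.
move=> /intrP[z xy] /andP[y0 y1]; rewrite /frac_part (floor_def (m := z)).
  by rewrite -xy; ring.
rewrite intrD -xy; apply/andP; split; lra.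
Qed.

(** The product of [lcm_upto (2 * n)] with
    ['C(2 * n, n) * euler_gamma R - tail_primitive R n n] differs from
    [ln (sondow_S R n)] by an integer, and lies in the open interval from [0]
    to [2 ^- n]. *)
Lemma frac_part_sondow (R : realType) n (p q : int) : (0 < n)%N ->
  (q %| (lcm_upto (2 * n) * 'C(2 * n, n))%N%:Z)%Z ->
  euler_gamma R = p%:~R / q%:~R ->
  frac_part (ln (sondow_S R n)) < 2 ^- n.
Proof.
move=> n0 qd gE; set d := lcm_upto (2 * n); set c := 'C(2 * n, n).
have d0 : (0 < d)%N by apply: lcm_upto_gt0.
have c0 : (0 < c)%N by rewrite bin_gt0 leq_pmull.
pose y : R := d%:R * (c%:R * euler_gamma R - tail_primitive R n n).
have /andP[I0 I1] := gamma_approx_bounds R n n0.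
have y0 : 0 < y by rewrite mulr_gt0 // ltr0n.
have p2 : 0 < 2 ^+ n :> R by rewrite exprn_gt0.
have y2 : y < 2 ^- n.
  have := lcm_upto_lt_central_bin R n n0; rewrite -/d -/c.
  have : y <= d%:R * (4 / ((2 * n).+1%:R * c%:R) ^+ 2) by rewrite ler_wpM2l.
  set b := _ ^+ 2 => yb db.
  have b0 : 0 < b by rewrite exprn_gt0 // mulr_gt0 // ltr0n.
  apply: le_lt_trans yb _; rewrite mulrA ltr_pdivrMr // [ltRHS]mulrC.
  by rewrite ltr_pdivlMr.
have y01 : 0 <= y < 1.
  by rewrite ltW //= (lt_le_trans y2) // invf_le1 // exprn_ege1 // ler1n.
suff yint : ln (sondow_S R n) - y \is a Num.int by rewrite (frac_part_small R _ y).
have -> : ln (sondow_S R n) - y =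
    \sum_(i < n.+1) 'C(n, i)%:R ^+ 2 * (d%:R * harmonic_sum R (n + i))
    - (d * c)%N%:R * euler_gamma R.
  rewrite [X in _ = X - _](eq_bigr (fun i : 'I_n.+1 =>
    d%:R * ('C(n, i)%:R ^+ 2 * harmonic_sum R (n + i)))) => [|i _].
    by rewrite -mulr_sumr ln_sondow_S -/d /y /tail_primitive sumrB natrM; ring.
  exact: mulrCA.
rewrite rpredB //.
  apply: rpred_sum => i _; rewrite rpredM ?rpredX ?natr_int //.
  by apply: lcm_upto_harmonic_int; have := ltn_ord i; lia.
have /dvdzP[m mE] := qd; rewrite -/d -/c in mE.
have q0 : q != 0.
  apply/eqP => q0; move: mE; rewrite q0 mulr0 => /eqP.
  by rewrite eqz_nat muln_eq0 -!leqn0 leqNgt d0 leqNgt c0.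
rewrite gE -[(d * c)%N%:R]/((d * c)%N%:Z%:~R) mE intrM.
by rewrite mulrACA [q%:~R * _]mulrC -mulrA mulVf ?intr_eq0 // mulr1 rpredM ?intr_int.
Qed.

Theorem corollary6 (R : realType) :
  (infinite_set [set n : nat |
      (0 < n)%N /\ (2 : R) ^- n <= frac_part (ln (sondow_S R n))] ->
    irrational (euler_gamma R))
  /\
  (forall n : nat, (0 < n)%N ->
    (2 : R) ^- n <= frac_part (ln (sondow_S R n)) ->
    forall p q : int, (q %| (lcm_upto (2 * n) * 'C(2 * n, n))%N%:Z)%Z ->
      euler_gamma R <> p%:~R / q%:~R).
Proof.
split=> [inf|n n0 hn p q qd gE]; last first.
  by have := frac_part_sondow R n p q n0 qd gE; rewrite ltNge hn.
case=> r _ rE; apply: inf.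
apply: (@sub_finite_set _ _ `I_(`|denq r|%N)); last exact: finite_II.
move=> n [n0 hn] /=; rewrite ltnNge; apply/negP => rn.
have qd : (denq r %| (lcm_upto (2 * n) * 'C(2 * n, n))%N%:Z)%Z.
  rewrite dvdzE dvdn_mulr // dvdn_lcm_upto // absz_gt0 denq_neq0 /=.
  by rewrite (leq_trans rn) // leq_pmull.
by have := frac_part_sondow R n (numq r) (denq r) n0 qd (esym rE); rewrite ltNge hn.
Qed.
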